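(* Let $\mathfrak g$ be a semisimple Lie algebra over an algebraically closed field $\Bbbk$ of characteristic $0$, and let $\sigma_1,\sigma_2$ be involutions of $\mathfrak g$ forming a dyad; put $\sigma_3=\sigma_1\sigma_2$. For $i,j\in\{0,1\}$ let $\mathfrak g_{ij}=\{x\in\mathfrak g:\sigma_1(x)=(-1)^ix,\ \sigma_2(x)=(-1)^jx\}$. Then every Cartan subspace $\mathfrak c_{11}$ of $\mathfrak g_{11}$ is also a Cartan subspace of $\mathfrak g_{10}\oplus\mathfrak g_{11}$ (the $(-1)$-eigenspace of $\sigma_1$) and of $\mathfrak g_{01}\oplus\mathfrak g_{11}$ (the $(-1)$-eigenspace of $\sigma_2$).
   Context: $\mathfrak g=\operatorname{Lie}(G)$ with $G$ a connected semisimple algebraic group; involutions of $\mathfrak g$ are assumed induced by involutions of $G$. Two involutions are conjugate if they lie in the same orbit of the group $\operatorname{Int}(G)$ of inner automorphisms acting by conjugation. A dyad is a pair of different, commuting, conjugate involutions. For an involution $\sigma$ of a reductive Lie algebra $\mathfrak h=\mathfrak h_0\oplus\mathfrak h_1$ ($\mathfrak h_i$ the $(-1)^i$-eigenspace), a Cartan subspace of $\mathfrak h_1$ is a maximal subspace of $\mathfrak h_1$ consisting of pairwise commuting semisimple elements; $\mathfrak g_{11}$ is the $(-1)$-eigenspace of the involution induced by $\sigma_1$ on $\mathfrak g^{\sigma_3}=\mathfrak g_{00}\oplus\mathfrak g_{11}$. *)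

(* Defs.v *)
From HB Require Import structures.
From mathcomp Require Import all_boot all_order all_algebra.
Set Implicit Arguments. Unset Strict Implicit. Unset Printing Implicit Defensive.
Import GRing.Theory.
Local Open Scope ring_scope.

Section Lie.
Variables (k : fieldType) (V : vectType k).
Implicit Types (br : V -> V -> V).

Definition lie_algebra br : Prop :=
  [/\ forall a x y z, br (a *: x + y) z = a *: br x z + br y z,
      forall a x y z, br z (a *: x + y) = a *: br z x + br z y,
      forall x, br x x = 0 &
      forall x y z, br x (br y z) + br y (br z x) + br z (br x y) = 0].

Definition lie_ideal br (I : {vspace V}) : Prop :=
  forall x y, y \in I -> br x y \in I.

(* derived algebra [I, I] : span of brackets (of basis vectors, by bilinearity) *)
Definition derived br (I : {vspace V}) : {vspace V} :=
  <<[seq br u v | u <- vbasis I, v <- vbasis I]>>%VS.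

Definition lie_solvable br (I : {vspace V}) : Prop :=
  exists m, iter m (derived br) I = 0%VS.

Definition semisimple_lie br : Prop :=
  lie_algebra br /\
  forall I : {vspace V}, lie_ideal br I -> lie_solvable br I -> I = 0%VS.

Definition ad_semisimple br (x : V) : Prop :=
  exists b : seq V, <<b>>%VS = fullv /\
    forall v, v \in b -> exists c : k, br x v = c *: v.

Definition ad_nilpotent br (x : V) : Prop :=
  forall y, iter (\dim {:V}) (br x) y = 0.

(* exp(ad x) for ad-nilpotent x (char 0) *)
Definition exp_ad br (x : V) (y : V) : V :=
  \sum_(i < (\dim {:V}).+1) ((i`!)%:R)^-1 *: iter i (br x) y.

Definition inner_aut br (phi : V -> V) : Prop :=
  exists xs : seq V, (forall x, x \in xs -> ad_nilpotent br x) /\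
    phi =1 foldr (fun x f => exp_ad br x \o f) id xs.

Definition lie_involution br (s : 'End(V)) : Prop :=
  [/\ forall x y, s (br x y) = br (s x) (s y),
      forall x, s (s x) = x &
      exists x, s x != x].

Definition inner_conjugate br (s1 s2 : 'End(V)) : Prop :=
  exists phi, inner_aut br phi /\ forall x, s2 (phi x) = phi (s1 x).

Definition dyad br (s1 s2 : 'End(V)) : Prop :=
  [/\ lie_involution br s1, lie_involution br s2,
      exists x, s1 x != s2 x,
      forall x, s1 (s2 x) = s2 (s1 x) &
      inner_conjugate br s1 s2].

Definition comm_semisimple br (c : {vspace V}) : Prop :=
  (forall x y, x \in c -> y \in c -> br x y = 0) /\
  (forall x, x \in c -> ad_semisimple br x).

Definition cartan_subspace br (P : V -> Prop) (c : {vspace V}) : Prop :=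
  [/\ forall x, x \in c -> P x,
      comm_semisimple br c &
      forall c' : {vspace V}, (c <= c')%VS -> (forall x, x \in c' -> P x) ->
        comm_semisimple br c' -> c' = c].

End Lie.

(* Main.v *)
(* Write sigma = s2, let phi be the inner automorphism with s2 phi = phi s1, and
   let a be a Cartan subspace of the (-1)-eigenspace of sigma.  It suffices to
   show dim a <= dim c.  For an automorphism psi put
   theta = sigma psi^-1 sigma psi; it is inverted by sigma.  With respect to the
   Killing form, the gradient v_j of theta |-> tr(theta^j) is fixed by theta, so
   v_j - sigma v_j lies in the (-1)-eigenspace of sigma and is fixed by theta.
   Let psi vary in a rational family joining tau^(ad h), h a generic rational
   point of a, to phi tau^(ad x), x a generic rational point of c.  At the first
   end theta is tau^(2 ad h) and these vectors span a space of dimension dim a;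
   at the second end theta is s2 s1 tau^(2 ad x), whose fixed vectors in the
   (-1)-eigenspace of sigma form c.  By semicontinuity of ranks, at a generic
   point of the family dim a <= dim (fixed vectors) <= dim c.

   The rational points come from the fact that a Q-linear functional applied to
   the weights of a Cartan subspace defines an inner derivation; the same device
   proves Cartan's criterion, i.e. that the Killing form is nondegenerate. *)
Require Import Defs.
From HB Require Import structures.
From mathcomp Require Import all_boot all_order all_algebra.
From mathcomp Require Import ring.
From Stdlib Require Import Classical IndefiniteDescription.
Set Implicit Arguments. Unset Strict Implicit. Unset Printing Implicit Defensive.
Import GRing.Theory VectorInternalTheory.
Local Open Scope ring_scope.

(** * Integral functionals *)

(** The obstacle lies at the first end. The space of fixed vectors can only shrink on passing from a
    special point to a generic one, which is what the second end needs and the opposite of what the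
    first end needs. The rank of an algebraic family of vectors, however, can only grow; so fixed
    vectors depending algebraically on [theta] are required, and the gradients of invariant
    functions supply them. Conjugacy enters as [phi^-1 sigma phi = s1]. Since [phi] is a product of
    exponentials of nilpotent elements, multiplying these elements by a parameter joins [phi] to the
    identity by a polynomial path. For semisimple elements there is no exponential over [k];
    integral eigenvalues replace it, because [tau^(ad h)] is then a rational function of [tau]. The
    ends use [tau = 2], which in characteristic 0 is not a root of unity, so that no weights are
    confused. The dimension bound suffices because [c] is itself a commuting semisimple subspace of
    both eigenspaces: a larger one would lie in a Cartan subspace of dimension at most [dim c]. The
    eigenspace of the other involution is carried over by [phi]. *)

Lemma ex_max_nat (P : nat -> Prop) b :
  (exists m, P m) -> (forall m, P m -> (m <= b)%N) ->
  exists2 m, P m & forall m', P m' -> (m' <= m)%N.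
Proof.
move=> [m0 Pm0] bnd; apply: NNPP => nex.
have /(_ b.+1)[m] : forall j, exists2 m, P m & (j <= m)%N.
  elim=> [|j [m Pm jm]]; first by exists m0.
  apply: NNPP => no; apply: nex; exists m => // m' Pm'.
  by rewrite leqNgt; apply/negP => lt; apply: no; exists m'; rewrite ?(leq_ltn_trans jm).
by move=> /bnd mn nm; move: (leq_trans nm mn); rewrite ltnn.
Qed.

(** A matrix of maximal rank among those with row space inside [E] has row space [E], and [K] is its
    cokernel. Linear conditions given by arbitrary propositions thus become subspaces. *)
Lemma row_subspaceP (F : fieldType) n (E : 'rV[F]_n -> Prop) :
  E 0 -> (forall a u v, E u -> E v -> E (a *: u + v)) ->
  exists K : 'M[F]_n, forall v, E v <-> v *m K = 0.
Proof.
move=> E0 Elin.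
pose sub m := exists2 A : 'M[F]_n, (forall u, (u <= A)%MS -> E u) & \rank A = m.
have [| |m [A AE rA] mmax] := @ex_max_nat sub n.
- by exists 0%N, 0; [move=> u; rewrite submx0 => /eqP-> | rewrite mxrank0].
- by move=> m [A _ <-]; exact: rank_leq_row.
exists (cokermx A) => v; split=> [Ev|/eqP]; last by rewrite -submxE => /AE.
apply/eqP; rewrite -submxE.
have /mmax : sub (\rank (A + v)%MS).
  exists (A + v)%MS => // u /sub_addsmxP[[u1 u2] /= ->].
  have [a ->] : exists a, u2 *m v = a *: v.
    by exists (u2 0 0); rewrite [u2]mx11_scalar mul_scalar_mx mxE eqxx mulr1n.
  by rewrite addrC; apply: Elin => //; apply: AE; rewrite submxMl.
rewrite -rA => le; have /leqifP := mxrank_leqif_sup (addsmxSl A v).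
case: ifP => [|_]; first by rewrite addsmx_sub => /andP[].
by rewrite ltnNge le.
Qed.

Lemma char0_natf_inj (F : fieldType) : [pchar F] =i pred0 ->
  injective (fun m : nat => m%:R : F).
Proof.
move=> /pcharf0P ch0.
have le m p : (m <= p)%N -> m%:R = p%:R :> F -> m = p.
  move=> mp /eqP; rewrite eq_sym -subr_eq0 -natrB // ch0 subn_eq0 => pm.
  by apply/eqP; rewrite eqn_leq mp.
by move=> m p; case/orP: (leq_total m p) => /le h e; [exact: h | symmetry; exact: h].
Qed.

(** The natural numbers below [size P] are distinct in [F] and outnumber the roots of the product
    [P]. This is how every generic point is found. *)
Lemma char0_nonroot (F : fieldType) (ps : seq {poly F}) : [pchar F] =i pred0 ->
  (forall p, p \in ps -> p != 0) ->
  exists t : F, forall p, p \in ps -> p.[t] != 0.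
Proof.
move=> ch0 ps0; pose P := \prod_(p <- ps) p.
have P0 : P != 0 by rewrite prodf_seq_neq0; apply/allP => p /ps0.
pose rs := [seq m%:R : F | m <- iota 0 (size P)].
have urs : uniq rs by rewrite map_inj_uniq ?iota_uniq //; exact: char0_natf_inj.
have : ~~ all (root P) rs.
  apply/negP => h; have := max_poly_roots P0 h urs.
  by rewrite size_map size_iota ltnn.
case/allPn => t _ nrt; exists t => p pin; apply: contra nrt => /eqP pt.
by rewrite /root /P horner_prod (big_rem p pin) /= pt mul0r.
Qed.

Lemma char0_mulrz_eq0 (F : fieldType) (U : lmodType F) (x : U) (m : int) :
  [pchar F] =i pred0 -> m != 0 -> x *~ m = 0 -> x = 0.
Proof.
move=> /pcharf0P ch0; case: m => m m0 xm; apply/eqP.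
  by move/eqP: xm m0; rewrite -[x *~ _]/(x *+ m) -scaler_nat scaler_eq0 ch0 => /orP[/eqP->|].
by move/eqP: xm; rewrite -[x *~ _]/(- (x *+ m.+1)) oppr_eq0 -scaler_nat scaler_eq0 ch0.
Qed.

(* The integral relations between the [w i] span a subspace of Q^n; [q] is a
   generic integral vector of its orthogonal. *)
Lemma separating_int_functional (F : fieldType) (U : lmodType F) n (w : 'I_n -> U) :
  [pchar F] =i pred0 ->
  exists q : 'I_n -> int,
    [/\ forall e : 'I_n -> int, \sum_i w i *~ e i = 0 -> \sum_i e i * q i = 0,
        forall i j, w i != w j -> q i != q j & forall i, w i != 0 -> q i != 0].
Proof.
move=> ch0.
(* The rational span of the integral relations: a vector belongs to it when some nonzero integral
   multiple is a relation. *)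
pose E (e : 'rV[rat]_n) := exists m (e' : 'I_n -> int),
  [/\ m != 0, forall i, e 0 i * m%:~R = (e' i)%:~R & \sum_i w i *~ e' i = 0].
have [||K EK] := @row_subspaceP _ _ E.
- exists 1, (fun=> 0); split=> // [i|]; first by rewrite mxE mul0r.
  by rewrite big1.
- move=> a u v [m1 [e1 [m10 ue1 r1]]] [m2 [e2 [m20 ve2 r2]]].
  exists (denq a * m1 * m2), (fun i => numq a * m2 * e1 i + denq a * m1 * e2 i).
  split; first by rewrite !mulf_neq0 ?denq_neq0.
    move=> i; rewrite !mxE rmorphD !rmorphM /= -ue1 -ve2.
    by rewrite numqE; ring.
  transitivity (\sum_i (w i *~ e1 i *~ (numq a * m2) + w i *~ e2 i *~ (denq a * m1))).
    by apply: eq_bigr => i _; rewrite mulrzDr -!mulrzA ![_ * (_ * _)]mulrC.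
  by rewrite big_split /= -!mulrz_suml r1 r2 !mul0rz addr0.
have EK0 e : \sum_i w i *~ e i = 0 -> \sum_i (e i)%:~R *: row i K = 0.
  move=> we; have /EK : E (\row_i (e i)%:~R).
    by exists 1, e; split=> // i; rewrite mxE mulr1.
  by rewrite mulmx_sum_row => {2}<-; apply: eq_bigr => i _; rewrite mxE.
have KE0 (e : 'I_n -> int) : \sum_i (e i)%:~R *: row i K = 0 -> \sum_i w i *~ e i = 0.
  move=> Ke; have /EK [m [e' [m0 ee' r]]] : (\row_i (e i)%:~R : 'rV_n) *m K = 0.
    by rewrite mulmx_sum_row -[RHS]Ke; apply: eq_bigr => i _; rewrite mxE.
  apply: (@char0_mulrz_eq0 F U _ m) => //; rewrite mulrz_suml -[RHS]r.
  apply: eq_bigr => i _; rewrite -mulrzA; congr (_ *~ _).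
  by have := ee' i; rewrite mxE -rmorphM => /intr_inj.
(* A vector of the orthogonal is [K] times a column. Columns [(1, t, t^2, ...)] are generic enough:
   coordinate [i] is then the value of [p i] at [t], and [ps] lists the polynomials whose roots [t]
   must avoid. *)
pose p i : {poly rat} := rVpoly (row i K).
pose ps := [seq r <- [seq p i - p j | i <- enum 'I_n, j <- enum 'I_n] ++
  [seq p i | i <- enum 'I_n] | r != 0].
have [|r|t tP] := @char0_nonroot rat ps; first exact: Num.Theory.pchar_num.
  by rewrite mem_filter => /andP[].
have prow i : p i = 0 -> row i K = 0.
  by move=> p0; rewrite -[row i K]rVpolyK -/(p i) p0 linear0.
have wdelta i j : \sum_l w l *~ ((l == i)%:R - (l == j)%:R) = w i - w j.
  under eq_bigr => l _ do rewrite mulrzBr.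
  rewrite sumrB (bigD1 i) //= eqxx big1 ?addr0 => [|l /negPf->]; last by rewrite mulr0z.
  by rewrite (bigD1 j) //= eqxx big1 ?addr0 => [|l /negPf->]; rewrite ?mulr0z ?mulr1z.
have Kdelta i : \sum_l (((l == i)%:R : int)%:~R : rat) *: row l K = row i K.
  rewrite (bigD1 i) //= eqxx big1 ?addr0 ?scale1r // => l /negPf->.
  by rewrite scale0r.
pose d := \prod_i denq (p i).[t].
have d0 : d != 0 by apply/prodf_neq0 => i _; rewrite denq_neq0.
have /fin_all_exists[q qP] i : exists q : int, q%:~R = d%:~R * (p i).[t].
  exists (numq (p i).[t] * \prod_(j | j != i) denq (p j).[t]).
  have -> : d = denq (p i).[t] * \prod_(j | j != i) denq (p j).[t] by rewrite /d (bigD1 i).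
  by rewrite !rmorphM /= numqE; ring.
have dQ0 : (d%:~R : rat) != 0 by rewrite intr_eq0.
exists q; split.
- move=> e /EK0 Ke; apply: (@intr_inj rat).
  rewrite rmorph_sum /=; under eq_bigr => i _ do rewrite rmorphM /= qP mulrCA.
  rewrite -mulr_sumr (_ : \sum_i _ = (rVpoly (\sum_i (e i)%:~R *: row i K)).[t]).
    by rewrite Ke linear0 horner0 mulr0.
  rewrite linear_sum horner_sum; apply: eq_bigr => i _.
  by rewrite linearZ hornerZ.
- move=> i j wij; apply/negP => /eqP /(congr1 (fun z : int => z%:~R : rat)).
  rewrite !qP => /(mulfI dQ0) /eqP; apply/negP.
  rewrite -subr_eq0 -hornerN -hornerD; apply: tP; rewrite mem_filter mem_cat.
  rewrite (_ : p i - p j \in [seq _ | _ <- _, _ <- _]) ?andbT; last first.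
    by apply/allpairsP; exists (i, j); rewrite !mem_enum.
  apply: contra wij; rewrite subr_eq0 => /eqP pij; rewrite -subr_eq0 -wdelta.
  apply/eqP/KE0; under eq_bigr => l _ do rewrite rmorphB scalerBl.
  rewrite sumrB !Kdelta; apply/eqP; rewrite subr_eq0; apply/eqP.
  by rewrite -[row i K]rVpolyK -/(p i) pij rVpolyK.
- move=> i wi; apply/negP => /eqP /(congr1 (fun z : int => z%:~R : rat)).
  rewrite qP => /eqP; rewrite mulf_eq0 (negPf dQ0); apply/negP; apply: tP.
  rewrite mem_filter mem_cat map_f ?mem_enum // orbT andbT.
  apply: contra wi => /eqP /prow Ki; apply/eqP.
  transitivity (\sum_l w l *~ (l == i)%:R); last by apply: KE0; rewrite Kdelta.
  by rewrite (bigD1 i) //= eqxx big1 ?addr0 // => l /negPf->; rewrite mulr0z.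
Qed.

(** Three relations matter: equality makes [q] a function of the weight, negation handles an
    involution acting by -1 on the Cartan subspace, and additivity makes the resulting diagonal map
    a derivation. *)
Lemma int_functional_additive (F : fieldType) (U : lmodType F) n (w : 'I_n -> U)
    (q : 'I_n -> int) :
  (forall e : 'I_n -> int, \sum_i w i *~ e i = 0 -> \sum_i e i * q i = 0) ->
  [/\ forall i j, w i = w j -> q i = q j, forall i j, w i = - w j -> q i = - q j &
      forall i j p, w p = w i + w j -> q p = q i + q j].
Proof.
move=> rel.
have wd i : \sum_l w l *~ (l == i)%:R = w i.
  by rewrite (bigD1 i) //= eqxx big1 ?addr0 // => l /negPf->; rewrite mulr0z.
have qd i : \sum_l ((l == i)%:R : int) * q l = q i.
  by rewrite (bigD1 i) //= eqxx mul1r big1 ?addr0 // => l /negPf->; rewrite mul0r.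
have lc (a b : int) i j p : w p = w i *~ a + w j *~ b -> q p = a * q i + b * q j.
  move=> wp; apply/eqP; rewrite -subr_eq0; apply/eqP.
  rewrite -[RHS](rel (fun l => (l == p)%:R - ((l == i)%:R * a + (l == j)%:R * b))).
    under [RHS]eq_bigr => l _ do rewrite mulrBl mulrDl ![_ * _ * q l]mulrAC.
    by rewrite sumrB big_split /= -!mulr_suml !qd ![q _ * _]mulrC.
  under eq_bigr => l _ do rewrite mulrzBr mulrzDr !mulrzA.
  by rewrite sumrB big_split /= -!mulrz_suml !wd wp subrr.
split=> [i j wij|i j wij|i j p wp].
- by have := lc 1 0 j j i; rewrite mulr1z mulr0z addr0 mul1r mul0r addr0; apply.
- by have := lc (-1) 0 j j i; rewrite mulrN1z mulr0z addr0 mulN1r mul0r addr0; apply.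
- by have := lc 1 1 i j p; rewrite !mulr1z !mul1r; apply.
Qed.

(** * Primary decomposition *)

Lemma coprimep_XsubC_prod (F : fieldType) m m' r (rs : seq F) : r \notin rs ->
  coprimep (\prod_(s <- rs) ('X - s%:P) ^+ m) (('X - r%:P) ^+ m').
Proof.
elim: rs => [|s rs IH]; first by rewrite big_nil coprime1p.
rewrite inE big_cons => /norP[rs0 /IH cop]; rewrite coprimepMl cop andbT.
by rewrite coprimep_expl // coprimep_expr // coprimep_XsubC root_XsubC.
Qed.

Lemma prod_XsubC_exp_dvdp (F : fieldType) m (rs : seq F) (p : {poly F}) : uniq rs ->
  (forall r, r \in rs -> ('X - r%:P) ^+ m %| p) ->
  \prod_(s <- rs) ('X - s%:P) ^+ m %| p.
Proof.
elim: rs => [|r rs IH]; first by rewrite big_nil dvd1p.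
move=> /= /andP[rnin urs] h; rewrite big_cons mulrC Gauss_dvdp ?coprimep_XsubC_prod //.
by rewrite h ?mem_head // andbT IH // => s sin; apply: h; rewrite inE sin orbT.
Qed.

Lemma poly_chinese (F : fieldType) m (rs : seq F) (q : F -> F) : uniq rs ->
  exists p : {poly F}, forall r, r \in rs -> ('X - r%:P) ^+ m %| p - (q r)%:P.
Proof.
elim: rs => [|r rs IH]; first by exists 0.
move=> /= /andP[rnin /IH[p hp]].
have /Bezout_eq1_coprimepP[[u v] /= uv] := coprimep_XsubC_prod m m rnin.
set A := \prod_(s <- rs) _ in uv; set B := (_ ^+ m) in uv.
exists (p + u * A * ((q r)%:P - p)) => s; rewrite inE => /orP[/eqP->|sin].
  have -> : p + u * A * ((q r)%:P - p) - (q r)%:P =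
      (u * A + v * B - 1) * ((q r)%:P - p) - v * B * ((q r)%:P - p) by ring.
  by rewrite uv subrr mul0r sub0r dvdpNr dvdp_mulr // dvdp_mull.
rewrite addrAC; apply: dvdp_add; first exact: hp.
by rewrite dvdp_mulr // dvdp_mull // /A (big_rem s sin) /= dvdp_mulr.
Qed.

Section Primary.
Variables (k : closedFieldType).

(** Every root receives the exponent [n], whatever its multiplicity, so that one exponent describes
    all generalized eigenspaces. *)
Lemma char_poly_dvdp_prod n (A : 'M[k]_n) :
  exists2 rs : seq k, uniq rs & char_poly A %| \prod_(r <- rs) ('X - r%:P) ^+ n.
Proof.
have [s sP] := closed_field_poly_normal (char_poly A).
have lc : lead_coef (char_poly A) = 1 by apply/eqP/char_poly_monic.
rewrite lc scale1r in sP.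
have ss : size s = n.
  by apply/eq_add_S; rewrite -(size_char_poly A) sP size_prod_XsubC.
exists (undup s); first exact: undup_uniq.
rewrite sP prodrXl; rewrite -[X in _ ^+ X]ss.
have : {subset s <= undup s} by move=> x; rewrite mem_undup.
elim: s {sP ss} (undup s) => [|x s IH] t sub; first by rewrite big_nil dvd1p.
rewrite big_cons exprS dvdp_mul //; last by apply: IH => y yin; apply: sub; rewrite inE yin orbT.
by rewrite (big_rem x) ?sub ?mem_head //= dvdp_mulr.
Qed.

Lemma horner_mx_dvdp0 n (A : 'M[k]_n.+1) p q :
  p %| q -> horner_mx A p = 0 -> horner_mx A q = 0.
Proof. by move=> /dvdpP[u ->] p0; rewrite rmorphM /= p0 mulr0. Qed.

Lemma horner_mx_XsubC_exp n (A : 'M[k]_n.+1) r m :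
  horner_mx A (('X - r%:P) ^+ m) = (A - r%:M) ^+ m.
Proof. by rewrite rmorphXn /= rmorphB /= horner_mx_X horner_mx_C. Qed.

(** [G] is a polynomial in [A] found by Chinese remainders, which is why it commutes with whatever
    commutes with [A]. If [r] is not among the roots, Bezout forces [v = 0], so the first clause
    holds for every [r]. *)
Lemma primary_function n (A : 'M[k]_n) (q : k -> k) :
  exists2 G : 'M[k]_n,
    forall r (v : 'rV_n), v *m (A - r%:M) ^+ n = 0 -> v *m G = q r *: v &
    forall B, A *m B = B *m A -> G *m B = B *m G.
Proof.
case: n A => [|n] A.
  by exists 0 => [r v _|B _]; rewrite [LHS]thinmx0 [RHS]thinmx0.
have [rs urs cA] := char_poly_dvdp_prod A.
have [p hp] := poly_chinese n.+1 q urs.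
exists (horner_mx A p) => [r v vr|B]; last by move=> AB; apply: comm_horner_mx.
have pr x : ('X - x%:P) ^+ n.+1 %| p - (q x)%:P -> v *m (A - x%:M) ^+ n.+1 = 0 ->
    v *m horner_mx A p = q x *: v.
  move=> /dvdpP[u pu] vx; have -> : p = ('X - x%:P) ^+ n.+1 * u + (q x)%:P.
    by rewrite mulrC -pu subrK.
  rewrite rmorphD rmorphM /= horner_mx_XsubC_exp horner_mx_C mulmxDr.
  by rewrite -[_ * _]/(_ *m _) mulmxA vx mul0mx add0r mul_mx_scalar.
have [rin|rnin] := boolP (r \in rs); first by apply: pr => //; exact: hp.
suff -> : v = 0 by rewrite mul0mx scaler0.
have /Bezout_eq1_coprimepP[[a b] /= ab] := coprimep_XsubC_prod n.+1 n.+1 rnin.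
rewrite -[v]mulmx1 -[1%:M](rmorph1 (horner_mx A)) -ab rmorphD /= mulmxDr.
rewrite (mulrC b) !rmorphM /= horner_mx_XsubC_exp.
rewrite [v *m (_ ^+ _ * _)]mulmxA vr mul0mx addr0.
rewrite [horner_mx A (\prod_(i <- _) _)](horner_mx_dvdp0 cA) ?mulr0 ?mulmx0 //.
exact: Cayley_Hamilton.
Qed.

(** The part of the characteristic polynomial away from [r] is coprime to [(X - r)^m], so a vector
    killed by the latter is already killed by [(X - r)^n]. *)
Lemma generalized_eigen_exponent n (A : 'M[k]_n) r (v : 'rV_n) m :
  v *m (A - r%:M) ^+ m = 0 -> v *m (A - r%:M) ^+ n = 0.
Proof.
case: n A v => [|n] A v vm; first by rewrite [LHS]thinmx0.
have [rs urs cA] := char_poly_dvdp_prod A.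
pose rs' := filter (predC1 r) rs.
have rnin : r \notin rs' by rewrite mem_filter /= eqxx.
have cA' : char_poly A %| ('X - r%:P) ^+ n.+1 * \prod_(s <- rs') ('X - s%:P) ^+ n.+1.
  apply: dvdp_trans cA _; apply: prod_XsubC_exp_dvdp => // s sin.
  have [->|sr] := eqVneq s r; first exact: dvdp_mulr.
  by apply: dvdp_mull; rewrite (big_rem s) ?mem_filter /= ?sr // dvdp_mulr.
have /Bezout_eq1_coprimepP[[a b] /= ab] := coprimep_XsubC_prod n.+1 m rnin.
rewrite -horner_mx_XsubC_exp -[X in horner_mx _ X]mulr1 -ab mulrDr rmorphD /= mulmxDr.
rewrite mulrCA rmorphM /= (horner_mx_dvdp0 cA' (Cayley_Hamilton A)) mulr0 mulmx0 add0r.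
rewrite (mulrCA (_ ^+ _) b) mulrA mulrC rmorphM /= horner_mx_XsubC_exp.
by rewrite [v *m (_ * _)]mulmxA vm mul0mx.
Qed.

(** The [E r] are the projections to the generalized eigenspaces, obtained from polynomials
    congruent to Kronecker deltas modulo the powers of the [X - s]. *)
Lemma primary_resolution n (A : 'M[k]_n) :
  exists (rs : seq k) (E : k -> 'M[k]_n),
    \sum_(r <- rs) E r = 1%:M /\ forall r, r \in rs -> E r *m (A - r%:M) ^+ n = 0.
Proof.
case: n A => [|n] A; first by exists [::], (fun=> 0); rewrite [LHS]thinmx0 [RHS]thinmx0.
have [rs urs cA] := char_poly_dvdp_prod A.
have ex s : exists p : {poly k},
    all (fun r => ('X - r%:P) ^+ n.+1 %| p - (r == s)%:R%:P) rs.
  by have [p hp] := poly_chinese n.+1 (fun r => (r == s)%:R) urs; exists p; apply/allP.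
pose e s := xchoose (ex s); have eP s r : r \in rs -> _ := allP (xchooseP (ex s)) r.
exists rs, (fun r => horner_mx A (e r)); split=> [|r rin].
  have : \prod_(r <- rs) ('X - r%:P) ^+ n.+1 %| \sum_(r <- rs) e r - 1.
    apply: prod_XsubC_exp_dvdp => // r rin.
    have -> : \sum_(s <- rs) e s - 1 = \sum_(s <- rs) (e s - (r == s)%:R%:P).
      rewrite sumrB (bigD1_seq r rin urs) /= [X in _ = _ - X](bigD1_seq r rin urs) /=.
      rewrite eqxx [X in _ = _ - (_ + X)]big1 ?addr0 // => s /negPf.
      by rewrite eq_sym => ->.
    elim/big_rec: _ => [|s p _ h]; first exact: dvdp0.
    by apply: dvdp_add => //; apply: eP.
  move=> /(dvdp_trans cA) /horner_mx_dvdp0 /(_ (Cayley_Hamilton A)).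
  by rewrite rmorphB rmorph1 rmorph_sum /= => /eqP; rewrite subr_eq0 => /eqP.
rewrite -horner_mx_XsubC_exp -[_ *m _]rmorphM /=.
apply: (horner_mx_dvdp0 _ (Cayley_Hamilton A)); apply: dvdp_trans cA _.
apply: prod_XsubC_exp_dvdp => // s sin; have [->|srn] := eqVneq s r.
  exact: dvdp_mull.
apply: dvdp_mulr; have := eP r s sin; by rewrite (negPf srn) subr0.
Qed.
End Primary.

(** * Traces and generalized eigenspaces *)

Lemma mxtrace_nilpotent (k : closedFieldType) n (A : 'M[k]_n) m : A ^+ m = 0 -> \tr A = 0.
Proof.
case: n A => [|n] A Am; first by rewrite [A]thinmx0 raddf0.
have [s sP] := closed_field_poly_normal (char_poly A).
rewrite (eqP (char_poly_monic A)) scale1r in sP.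
have s0 x : x \in s -> x = 0.
  move=> xs; have : root (char_poly A) x by rewrite sP root_prod_XsubC.
  rewrite -eigenvalue_root_char => /eigenvalueP[v vA v0].
  have : v *m A ^+ m = x ^+ m *: v.
    elim: m {Am} => [|m IH]; first by rewrite expr0 mulmx1 scale1r.
    by rewrite exprSr mulmxA IH -scalemxAl vA scalerA -exprSr.
  rewrite Am mulmx0 => /esym/eqP; rewrite scaler_eq0 (negPf v0) orbF.
  by rewrite expf_eq0 => /andP[_ /eqP].
have ss : size s = n.+1.
  by apply/eq_add_S; rewrite -(size_char_poly A) sP size_prod_XsubC.
have : (char_poly A)`_n = 0.
  rewrite sP (eq_big_seq (fun=> 'X)) => [|x /s0->]; last by rewrite subr0.
  by rewrite big_const_seq count_predT iter_mulr_1 ss coefXn ltn_eqF.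
by rewrite char_poly_trace // => /eqP; rewrite oppr_eq0 => /eqP.
Qed.

Section Lfun.
Variables (k : closedFieldType) (V : vectType k).
Implicit Types (f g h : 'End(V)) (u v : V).
Local Notation n := (\dim {:V}).

Lemma v2r_lfun f v : v2r (f v) = v2r v *m f2mx f.
Proof. by rewrite unlock /= r2vK. Qed.

Lemma v2r_iter f m v : v2r (iter m f v) = v2r v *m f2mx f ^+ m.
Proof.
elim: m => [|m IH]; first by rewrite expr0 mulmx1.
by rewrite /= v2r_lfun IH exprSr mulmxA.
Qed.

Lemma mx_v2r_inj (A B : 'M[k]_(dim V)) :
  (forall v, v2r v *m A = v2r v *m B) -> A = B.
Proof.
by move=> h; apply/row_matrixP => i; rewrite !rowE -[delta_mx _ _]r2vK.
Qed.

Lemma f2mx_comp f g : f2mx (f \o g)%VF = f2mx g *m f2mx f.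
Proof. by apply: mx_v2r_inj => v; rewrite mulmxA -!v2r_lfun comp_lfunE. Qed.

Lemma f2mxD f g : f2mx (f + g) = f2mx f + f2mx g.
Proof. by apply: mx_v2r_inj => v; rewrite mulmxDr -!v2r_lfun add_lfunE linearD. Qed.

Lemma f2mxZ a f : f2mx (a *: f) = a *: f2mx f.
Proof. by apply: mx_v2r_inj => v; rewrite -scalemxAr -!v2r_lfun scale_lfunE linearZ. Qed.

Lemma f2mx1 : f2mx (\1%VF : 'End(V)) = 1%:M.
Proof. by apply: mx_v2r_inj => v; rewrite mulmx1 -!v2r_lfun id_lfunE. Qed.

Lemma f2mx_sub_scalar f a : f2mx (f - a *: \1%VF) = f2mx f - a%:M.
Proof. by rewrite -scaleNr f2mxD f2mxZ f2mx1 scalemx1 raddfN. Qed.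

Lemma Hom_v2r (A : 'M[k]_(dim V)) v : (Hom A : 'End(V)) v = r2v (v2r v *m A).
Proof. by rewrite -[LHS]v2rK v2r_lfun. Qed.

Definition ltr f : k := \tr (f2mx f).

Lemma ltrD f g : ltr (f + g) = ltr f + ltr g.
Proof. by rewrite /ltr f2mxD raddfD. Qed.

Lemma ltrZ a f : ltr (a *: f) = a * ltr f.
Proof. by rewrite /ltr f2mxZ linearZ. Qed.

Lemma ltrN f : ltr (- f) = - ltr f.
Proof. by rewrite -scaleN1r ltrZ mulN1r. Qed.

Lemma ltrB f g : ltr (f - g) = ltr f - ltr g.
Proof. by rewrite ltrD ltrN. Qed.

Lemma ltrC f g : ltr (f \o g)%VF = ltr (g \o f)%VF.
Proof. by rewrite /ltr !f2mx_comp mxtrace_mulC. Qed.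

Lemma ltr_nilpotent f m : (forall v, iter m f v = 0) -> ltr f = 0.
Proof.
move=> h; apply: (@mxtrace_nilpotent _ _ _ m); apply: mx_v2r_inj => v.
by rewrite -v2r_iter h linear0 mulmx0.
Qed.

(** [P] and [Q] are inverse changes of basis between [b] and the canonical coordinates. Their types
    are rectangular because [n] and [dim V] are equal only by a lemma. *)
Lemma ltr_basis (b : n.-tuple V) f : basis_of fullv b ->
  ltr f = \sum_i coord b i (f b`_i).
Proof.
move=> bb; pose P := b2mx b; pose C : 'M[k]_n := \matrix_(i, j) coord b j (f b`_i).
pose Q : 'M[k]_(dim V, n) := \matrix_i (\row_j coord b j (r2v (delta_mx 0 i))).
have QP : Q *m P = 1%:M.
  apply/row_matrixP => i; rewrite rowE mulmxA -rowE rowK rowE mulmx1 mulmx_sum_row.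
  rewrite -[RHS]r2vK [r2v _ in RHS](coord_basis bb (memvf _)) linear_sum /=.
  by apply: eq_bigr => j _; rewrite mxE linearZ /= rowK (tnth_nth 0).
have PA : P *m f2mx f = C *m P.
  apply/row_matrixP => i; rewrite !rowE !mulmxA -!rowE !rowK -v2r_lfun (tnth_nth 0).
  rewrite [f _ in LHS](coord_basis bb (memvf _)) linear_sum mulmx_sum_row /=.
  by apply: eq_bigr => j _; rewrite !mxE linearZ /= rowK (tnth_nth 0).
have PQ : P *m Q = 1%:M.
  apply/matrixP => i j; rewrite [RHS]mxE -(coord_free i j (basis_free bb)).
  rewrite (_ : b`_i = r2v (row i P)); last by rewrite rowK v2rK (tnth_nth 0).
  rewrite [in RHS](row_sum_delta (row i P)) !linear_sum mxE /=.
  by apply: eq_bigr => l _; rewrite !mxE !linearZ.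
rewrite /ltr -[f2mx f]mul1mx -QP -mulmxA mxtrace_mulC PA -mulmxA PQ mulmx1.
by apply: eq_bigr => i _; rewrite mxE.
Qed.

Lemma primary_lfun f (q : k -> k) : exists2 g : 'End(V),
  forall r v, iter n (f - r *: \1%VF) v = 0 -> g v = q r *: v &
  forall h, (f \o h = h \o f)%VF -> (g \o h = h \o g)%VF.
Proof.
have [G Gr GC] := primary_function (f2mx f) q; exists (Hom G) => [r v vr|h fh].
  rewrite Hom_v2r (Gr r); first by rewrite linearZ /= v2rK.
  by rewrite -f2mx_sub_scalar -[X in _ ^+ X]dimvf -v2r_iter vr linear0.
apply: val_inj; rewrite /= !f2mx_comp GC //=.
by rewrite -!f2mx_comp fh.
Qed.

Lemma generalized_eigen_dim f r v m :
  iter m (f - r *: \1%VF) v = 0 -> iter n (f - r *: \1%VF) v = 0.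
Proof.
move=> /(congr1 v2r) h; apply: v2r_inj; rewrite linear0 v2r_iter f2mx_sub_scalar dimvf.
apply: (@generalized_eigen_exponent _ _ _ _ _ m).
by rewrite -f2mx_sub_scalar -v2r_iter h linear0.
Qed.

Lemma span_basis_subseq (s : seq V) : exists2 b : seq V, {subset b <= s} & basis_of <<s>> b.
Proof.
elim: s => [|v s [b bs bb]]; first by exists [::] => //; rewrite span_nil nil_basis.
have [vin|vnin] := boolP (v \in <<s>>%VS).
  exists b; first by move=> x /bs xs; rewrite inE xs orbT.
  by rewrite span_cons (addv_idPr _).
exists (v :: b); first by move=> x; rewrite !inE => /orP[->//|/bs->]; rewrite orbT.
rewrite /basis_of !span_cons (span_basis bb) eqxx free_cons (span_basis bb) vnin.
exact: basis_free bb.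
Qed.

Lemma generalized_eigenbasis f : exists2 b : n.-tuple V, basis_of fullv b &
  exists l : 'I_n -> k, forall i, iter n (f - l i *: \1%VF) b`_i = 0.
Proof.
have [rs [E [sE Er]]] := primary_resolution (f2mx f).
pose s := [seq r2v (row i (E r)) | r <- rs, i <- enum 'I_(dim V)].
have sP v : v \in s -> exists l, iter n (f - l *: \1%VF) v == 0.
  move=> /allpairsP[[r i] /= [rin _ ->]]; exists r.
  apply/eqP/v2r_inj; rewrite v2r_iter f2mx_sub_scalar r2vK dimvf -row_mul Er //.
  by rewrite !linear0.
have sf : <<s>>%VS = fullv.
  apply/eqP; rewrite eqEsubv subvf; apply/subvP => v _.
  rewrite -[v]v2rK -[v2r v]mulmx1 -sE mulmx_sumr linear_sum big_seq.
  apply: memv_suml => r rin; rewrite mulmx_sum_row linear_sum memv_suml // => i _.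
  by rewrite linearZ memvZ // memv_span //; apply/allpairsP; exists (r, i); rewrite mem_enum.
have [b bs] := span_basis_subseq s; rewrite sf => bb.
have sb : size b == n by rewrite (size_basis (X := in_tuple b) bb).
exists (Tuple sb) => //.
have h (i : 'I_n) : exists l, iter n (f - l *: \1%VF) b`_i == 0.
  by apply: sP; apply: bs; rewrite mem_nth // (eqP sb).
by exists (fun i => xchoose (h i)) => i; apply/eqP/(xchooseP (h i)).
Qed.
End Lfun.

(** * Simultaneous diagonalization and subspaces given by predicates *)

Section Codiagonalization.
Variables (k : closedFieldType) (V : vectType k).
Implicit Types (f g h : 'End(V)) (u v : V).
Local Notation n := (\dim {:V}).

Definition diagonal_lfun f : Prop :=
  exists b : seq V, <<b>>%VS = fullv /\ forall v, v \in b -> exists c : k, f v = c *: v.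

Lemma lfun_eq_on_span (b : seq V) f g : <<b>>%VS = fullv ->
  (forall v, v \in b -> f v = g v) -> f = g.
Proof.
move=> bf fg; apply/lfunP => v.
apply/eqlfunP; have : (<<b>> <= lker (f - g))%VS.
  by apply/span_subvP => u /fg e; apply/eqlfunP.
by rewrite bf => /subvP; apply; exact: memvf.
Qed.

Lemma eigen_generalized f r v : f v = r *: v -> iter n (f - r *: \1%VF) v = 0.
Proof.
move=> fv; have [n0|] := posnP n.
  by rewrite n0 /=; apply/eqP; rewrite -memv0 (eqP (_ : 0 == fullv)%VS) ?memvf // eq_sym -dimv_eq0 n0.
case: (\dim {:V}) => // m _; rewrite iterSr add_lfunE opp_lfunE scale_lfunE id_lfunE fv subrr.
by elim: m => //= m ->; rewrite linear0.
Qed.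

(** Induction on the list: the spectral projections of the new [f] commute with the remaining maps,
    so they send common eigenvectors of these to common eigenvectors, now also of [f]. Only spanning
    families are carried along; a basis is extracted at the end. *)
Lemma codiagonalization (fs : seq 'End(V)) :
  (forall f g, f \in fs -> g \in fs -> (f \o g = g \o f)%VF) ->
  (forall f, f \in fs -> diagonal_lfun f) ->
  exists2 b : n.-tuple V, basis_of fullv b &
    forall f, f \in fs -> forall i : 'I_n, exists c : k, f b`_i = c *: b`_i.
Proof.
move=> comm dg.
suff [s sf sP] : exists2 s : seq V, <<s>>%VS = fullv &
    forall f, f \in fs -> forall v, v \in s -> exists c : k, f v = c *: v.
  have [b bs] := span_basis_subseq s; rewrite sf => bb.
  have sb : size b == n by rewrite (size_basis (X := in_tuple b) bb).
  exists (Tuple sb) => // f fin i; apply: sP => //; apply: bs.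
  by rewrite mem_nth ?(eqP sb).
elim: fs comm dg => [|f fs IH] comm dg.
  by exists (vbasis fullv) => //; apply: span_basis; apply: vbasisP.
have [||s sf sP] := IH.
- by move=> g h gin hin; apply: comm; rewrite inE ?gin ?hin orbT.
- by move=> g gin; apply: dg; rewrite inE gin orbT.
have [b0 [b0f b0P]] := dg f (mem_head _ _).
have [rs rsP] : exists rs : seq k, uniq rs /\ forall v, v \in b0 ->
    exists2 c, c \in rs & f v = c *: v.
  suff [rs rsP] : exists rs : seq k, forall v, v \in b0 -> exists2 c, c \in rs & f v = c *: v.
    exists (undup rs); split; first exact: undup_uniq.
    by move=> v /rsP[c cin ?]; exists c; rewrite ?mem_undup.
  elim: (b0) b0P => [|v l IHl] h; first by exists [::].
  have [u uin|rs rsP] := IHl; first by apply: h; rewrite inE uin orbT.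
  have [c fc] := h v (mem_head _ _); exists (c :: rs) => u; rewrite inE => /orP[/eqP->|/rsP[d din fd]].
    by exists c; rewrite ?mem_head.
  by exists d; rewrite // inE din orbT.
have [urs {}rsP] := rsP.
have [e eP] : exists e : k -> 'End(V), forall r,
    (forall l v, f v = l *: v -> e r v = (l == r)%:R *: v) /\
    forall h, (f \o h = h \o f)%VF -> (e r \o h = h \o e r)%VF.
  apply: (@functional_choice k 'End(V) (fun r e => (forall l v, f v = l *: v -> e v = (l == r)%:R *: v) /\
    forall h, (f \o h = h \o f)%VF -> (e \o h = h \o e)%VF)).
  move=> r; have [g gr gc] := primary_lfun f (fun l => (l == r)%:R).
  by exists g; split=> // l v /eigen_generalized; apply: gr.
have esum : (\sum_(r <- rs) e r = \1)%VF.
  apply: (lfun_eq_on_span b0f) => v /rsP[l lin fl]; rewrite sum_lfunE id_lfunE.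
  rewrite (bigD1_seq l lin urs) /= ((eP l).1 l) // eqxx scale1r big1 ?addr0 // => r rl.
  by rewrite ((eP r).1 l) // eq_sym (negPf rl) scale0r.
have fe r : (f \o e r = r *: e r)%VF.
  apply: (lfun_eq_on_span b0f) => v /rsP[l lin fl].
  rewrite comp_lfunE scale_lfunE ((eP r).1 l) // linearZ /= fl.
  by case: eqP => [->|]; rewrite ?scale1r // !scale0r scaler0.
exists [seq e r v | r <- rs, v <- s].
  apply/eqP; rewrite eqEsubv subvf; apply/subvP => v _.
  rewrite -[v]id_lfunE -esum sum_lfunE big_seq; apply: memv_suml => r rin.
  have : (e r @: <<s>> <= <<[seq e r v | r <- rs, v <- s]>>)%VS.
    rewrite limg_span; apply/span_subvP => u /mapP[w ws ->]; apply: memv_span.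
    by apply/allpairsP; exists (r, w).
  by move/subvP; apply; rewrite sf memv_img ?memvf.
move=> g gin v /allpairsP[[r w] /= [rin ws ->]].
move: gin; rewrite inE => /orP[/eqP->|gin].
  by exists r; rewrite -comp_lfunE fe scale_lfunE.
have [c gw] := sP g gin w ws; exists c.
rewrite -comp_lfunE -(eP r).2; first by rewrite comp_lfunE gw linearZ.
by apply: comm; rewrite inE ?eqxx ?gin ?orbT.
Qed.

Lemma iter_lfun_comm f g m v : (f \o g = g \o f)%VF -> iter m f (g v) = g (iter m f v).
Proof.
by move=> fg; elim: m => //= m ->; rewrite -!comp_lfunE fg.
Qed.

Lemma iter_comp_comm f g m v : (f \o g = g \o f)%VF ->
  iter m (f \o g)%VF v = iter m f (iter m g v).
Proof.
move=> fg; elim: m v => //= m IH v; rewrite IH comp_lfunE.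
by rewrite -(iter_lfun_comm m (iter m g v) fg).
Qed.

Lemma ltr_nilpotent_comm f g m : (f \o g = g \o f)%VF ->
  (forall v, iter m g v = 0) -> ltr (f \o g)%VF = 0.
Proof.
move=> fg h; apply: (@ltr_nilpotent _ _ _ m) => v.
rewrite iter_comp_comm // h; elim: m {h} => //= m ->; exact: linear0.
Qed.

Lemma vspace_of_pred (P : V -> Prop) : P 0 ->
  (forall a u v, P u -> P v -> P (a *: u + v)) ->
  exists U : {vspace V}, forall v, v \in U <-> P v.
Proof.
move=> P0 Pl; have [||K KP] := @row_subspaceP _ _ (fun r => P (r2v r)).
- by rewrite linear0.
- by move=> a u v Pu Pv; rewrite linearP; apply: Pl.
exists (lker (Hom K)) => v; rewrite -{2}[v]v2rK KP memv_ker Hom_v2r.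
split=> [/eqP/(congr1 v2r)|->]; last by rewrite linear0.
by rewrite r2vK linear0.
Qed.
End Codiagonalization.

(** * Lie algebras and Engel's theorem *)

Section LieBasics.
Variables (k : closedFieldType) (V : vectType k) (br : V -> V -> V).
Hypothesis La : lie_algebra br.
Implicit Types (f g h : 'End(V)) (u v x y z : V).
Local Notation n := (\dim {:V}).

Lemma brPl a x y z : br (a *: x + y) z = a *: br x z + br y z.
Proof. by case: La. Qed.
Lemma brPr a x y z : br z (a *: x + y) = a *: br z x + br z y.
Proof. by case: La. Qed.
Lemma brxx x : br x x = 0.
Proof. by case: La. Qed.
Lemma brDl x y z : br (x + y) z = br x z + br y z.
Proof. by have := brPl 1 x y z; rewrite !scale1r. Qed.
Lemma brDr x y z : br z (x + y) = br z x + br z y.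
Proof. by have := brPr 1 x y z; rewrite !scale1r. Qed.
Lemma br0l z : br 0 z = 0.
Proof. by apply: (addrI (br 0 z)); rewrite -brDl !addr0. Qed.
Lemma br0r z : br z 0 = 0.
Proof. by apply: (addrI (br z 0)); rewrite -brDr !addr0. Qed.
Lemma brZl a x z : br (a *: x) z = a *: br x z.
Proof. by have := brPl a x 0 z; rewrite addr0 br0l addr0. Qed.
Lemma brZr a x z : br z (a *: x) = a *: br z x.
Proof. by have := brPr a x 0 z; rewrite addr0 br0r addr0. Qed.
Lemma brNl x z : br (- x) z = - br x z.
Proof. by rewrite -scaleN1r brZl scaleN1r. Qed.
Lemma brNr x z : br z (- x) = - br z x.
Proof. by rewrite -scaleN1r brZr scaleN1r. Qed.
Lemma br_anti x y : br x y = - br y x.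
Proof.
apply/eqP; rewrite -addr_eq0; have := brxx (x + y).
by rewrite brDl !brDr !brxx add0r addr0 => ->.
Qed.
Lemma br_jacobi x y z : br (br x y) z = br x (br y z) - br y (br x z).
Proof.
have [_ _ _ J] := La; have := J x y z.
rewrite (br_anti z (br x y)) (br_anti z x) brNr => /eqP.
by rewrite subr_eq0 => /eqP.
Qed.
Lemma br_suml I (r : seq I) (P : pred I) (F : I -> V) z :
  br (\sum_(i <- r | P i) F i) z = \sum_(i <- r | P i) br (F i) z.
Proof. by elim/big_rec2: _ => [|i a b _ <-]; rewrite ?br0l ?brDl. Qed.
Lemma br_sumr I (r : seq I) (P : pred I) (F : I -> V) z :
  br z (\sum_(i <- r | P i) F i) = \sum_(i <- r | P i) br z (F i).
Proof. by elim/big_rec2: _ => [|i a b _ <-]; rewrite ?br0r ?brDr. Qed.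

(** [br] is a bare function, so the endomorphism is assembled from its values on the coordinate
    vectors. *)
Definition ad x : 'End(V) := Hom (\matrix_i v2r (br x (r2v (delta_mx 0 i)))).

Lemma adE x y : ad x y = br x y.
Proof.
rewrite Hom_v2r mulmx_sum_row linear_sum -{2}[y]v2rK {2}[v2r y]row_sum_delta.
rewrite linear_sum br_sumr; apply: eq_bigr => i _.
by rewrite rowK !linearZ /= v2rK brZr.
Qed.

Lemma adP a x y : ad (a *: x + y) = a *: ad x + ad y.
Proof. by apply/lfunP => z; rewrite add_lfunE scale_lfunE !adE brPl. Qed.
Lemma adD x y : ad (x + y) = ad x + ad y.
Proof. by apply/lfunP => z; rewrite add_lfunE !adE brDl. Qed.
Lemma adZ a x : ad (a *: x) = a *: ad x.
Proof. by apply/lfunP => z; rewrite scale_lfunE !adE brZl. Qed.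
Lemma adN x : ad (- x) = - ad x.
Proof. by rewrite -scaleN1r adZ scaleN1r. Qed.
Lemma ad_br x y : ad (br x y) = (ad x \o ad y)%VF - (ad y \o ad x)%VF.
Proof.
by apply/lfunP => z; rewrite add_lfunE opp_lfunE !comp_lfunE !adE br_jacobi.
Qed.

Lemma iter_ad m x y : iter m (ad x) y = iter m (br x) y.
Proof. by elim: m => //= m ->; rewrite adE. Qed.

Definition derivation f := forall x y, f (br x y) = br (f x) y + br x (f y).

Lemma ad_derivation x : derivation (ad x).
Proof.
move=> y z; rewrite !adE; apply/eqP.
by rewrite eq_sym br_jacobi subrK.
Qed.

Lemma derivation_ad f x : derivation f -> ad (f x) = (f \o ad x)%VF - (ad x \o f)%VF.
Proof.
move=> df; apply/lfunP => z; rewrite add_lfunE opp_lfunE !comp_lfunE !adE df.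
by rewrite addrK.
Qed.

Definition killing x y : k := ltr (ad x \o ad y)%VF.

Lemma killingC x y : killing x y = killing y x.
Proof. exact: ltrC. Qed.
Lemma killingPl a x y z : killing (a *: x + y) z = a * killing x z + killing y z.
Proof. by rewrite /killing adP comp_lfunDl -comp_lfunZl ltrD ltrZ. Qed.
Lemma killingDl x y z : killing (x + y) z = killing x z + killing y z.
Proof. by have := killingPl 1 x y z; rewrite scale1r mul1r. Qed.
Lemma killing0l z : killing 0 z = 0.
Proof. by have := killingDl 0 0 z; rewrite addr0 => /eqP; rewrite -subr_eq0 opprD addNKr oppr_eq0 => /eqP. Qed.
Lemma killingZl a x z : killing (a *: x) z = a * killing x z.
Proof. by have := killingPl a x 0 z; rewrite killing0l !addr0. Qed.
Lemma killingNl x z : killing (- x) z = - killing x z.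
Proof. by rewrite -scaleN1r killingZl mulN1r. Qed.
Lemma killingDr x y z : killing z (x + y) = killing z x + killing z y.
Proof. by rewrite !(killingC z) killingDl. Qed.
Lemma killingZr a x z : killing z (a *: x) = a * killing z x.
Proof. by rewrite !(killingC z) killingZl. Qed.
Lemma killingNr x z : killing z (- x) = - killing z x.
Proof. by rewrite !(killingC z) killingNl. Qed.

Lemma ltr_commutator f g h :
  ltr (((f \o g)%VF - (g \o f)%VF) \o h)%VF = ltr (f \o ((g \o h)%VF - (h \o g)%VF))%VF.
Proof.
rewrite comp_lfunDl comp_lfunDr comp_lfunNl comp_lfunNr !ltrB !comp_lfunA; congr (_ - _).
by rewrite -comp_lfunA ltrC.
Qed.

Lemma killing_inv x y z : killing (br x y) z = killing x (br y z).
Proof. by rewrite /killing !ad_br ltr_commutator. Qed.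

Definition subalgebra (H : {vspace V}) := forall x y, x \in H -> y \in H -> br x y \in H.

(** A pair [W1 <= W2] stands for the quotient module [W2 / W1]. Let [H'] be a maximal proper
    subalgebra; by induction on its action on [H / H'], some [y] outside [H'] normalizes it, and
    [H = H' + <y>] by maximality. The vectors killed by [H'] modulo [W1] are stable under [y]; the
    last iterate of [br y] outside [W1] is the vector sought. *)
Lemma engel d (H W1 W2 : {vspace V}) : (\dim H <= d)%N -> subalgebra H ->
  (forall x v, x \in H -> iter n (br x) v = 0) ->
  (W1 <= W2)%VS -> ~~ (W2 <= W1)%VS ->
  (forall x v, x \in H -> v \in W1 -> br x v \in W1) ->
  (forall x v, x \in H -> v \in W2 -> br x v \in W2) ->
  exists v, [/\ v \in W2, v \notin W1 & forall x, x \in H -> br x v \in W1].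
Proof.
elim: d H W1 W2 => [|d IH] H W1 W2 dH sH nil W12 nW s1 s2.
  have /subvPn[v v2 v1] := nW; exists v; split=> // x.
  by move: dH; rewrite leqn0 dimv_eq0 => /eqP->; rewrite memv0 => /eqP->; rewrite br0l mem0v.
have [H0|Hn0] := eqVneq H 0%VS.
  by apply: IH => //; rewrite H0 dimv0.
pose P m := exists H' : {vspace V}, [/\ (H' <= H)%VS, (\dim H' < \dim H)%N, subalgebra H' & \dim H' = m].
have [||_ [H' [H'H dH' sH' <-]] mx] := @ex_max_nat P (\dim H).
- exists 0%N, 0%VS; split; rewrite ?sub0v ?dimv0 //.
    by rewrite lt0n dimv_eq0.
  by move=> x y; rewrite !memv0 => /eqP->; rewrite br0l.
- by move=> m [H' [_ lt _ <-]]; exact: ltnW.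
have inH x : x \in H' -> x \in H by apply/subvP.
have dH'd : (\dim H' <= d)%N by rewrite -ltnS (leq_trans dH').
have [||||y [yH yH' yP]] := IH H' H' H dH'd sH' _ H'H.
- by move=> x v /inH; apply: nil.
- by apply/negP => /dimvS; rewrite leqNgt dH'.
- exact: sH'.
- by move=> x v /inH; apply: sH.
have HE : (H' + <[y]>)%VS = H.
  apply/eqP; rewrite eqEdim subv_add H'H -memvE yH /= leqNgt; apply/negP => lt.
  have /mx : P (\dim (H' + <[y]>)); last first.
    rewrite leqNgt => /negP; apply; rewrite ltn_neqAle dimvS ?addvSl // andbT.
    apply: contra yH' => dE; have /eqP-> : (H' == H' + <[y]>)%VS.
      by rewrite eqEdim addvSl (eqP dE) leqnn.
    by apply: (subvP (addvSr _ _)); rewrite memv_line.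
  exists (H' + <[y]>)%VS; split=> //; first by rewrite subv_add H'H -memvE yH.
  move=> _ _ /memv_addP[a aH [_ /vlineP[b ->] ->]] /memv_addP[c cH [_ /vlineP[e ->] ->]].
  apply: (subvP (addvSl _ _)); rewrite brDl !brDr !brZl !brZr brxx !scaler0 addr0.
  rewrite (br_anti y c); apply: rpredD; last by rewrite rpredZ // rpredN yP.
  by apply: rpredD; [exact: sH' | rewrite rpredZ // yP].
pose P' v := v \in W2 /\ forall x, x \in H' -> br x v \in W1.
have [||W' W'P] := @vspace_of_pred _ _ P'.
- by split; [exact: mem0v | move=> x _; rewrite br0r mem0v].
- move=> a u v [u2 uP] [v2 vP]; split; first by rewrite rpredD ?rpredZ.
  by move=> x xH; rewrite brPr rpredD ?rpredZ ?uP ?vP.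
have [|||v [v2 v1 vP]] := IH H' W1 W2 dH'd sH' _ W12 nW.
- by move=> x v /inH; apply: nil.
- by move=> x v /inH; apply: s1.
- by move=> x v /inH; apply: s2.
have yW w : P' w -> P' (br y w).
  move=> [w2 wP]; split; first exact: s2.
  move=> x xH; have -> : br x (br y w) = br (br x y) w + br y (br x w).
    by rewrite br_jacobi subrK.
  by rewrite rpredD ?wP ?yP // s1 ?wP.
have [w [w' w1 yw]] : exists w, [/\ P' w, w \notin W1 & br y w \in W1].
  have : P' v by [].
  move: (nil y v yH) v1; elim: (\dim {:V}) v {v2 vP} => [|m IHm] v /=.
    by move=> ->; rewrite mem0v.
  rewrite -iterS iterSr => hm v1 v'.
  have [yv1|yv1] := boolP (br y v \in W1); first by exists v.
  by apply: (IHm (br y v)) => //; exact: yW.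
exists w; split=> //; first by case: w'.
move=> x; rewrite -HE => /memv_addP[a aH [_ /vlineP[b ->] ->]].
by rewrite brDl brZl rpredD ?rpredZ //; case: w' => _; apply.
Qed.

(** If [D] were nonzero, a maximal proper [D]-stable subspace [W] would have codimension 1 by Engel,
    with [D] mapping a complementary line into [W]; then all brackets of [D] lie in [W], against
    perfectness. *)
Lemma engel_perfect (D : {vspace V}) : subalgebra D ->
  (forall x v, x \in D -> iter n (br x) v = 0) ->
  (forall W : {vspace V}, (forall x y, x \in D -> y \in D -> br x y \in W) -> (D <= W)%VS) ->
  D = 0%VS.
Proof.
move=> sD nil perf; apply/eqP; apply: contraT => Dn0.
pose P m := exists W : {vspace V}, [/\ (W <= D)%VS, (\dim W < \dim D)%N,
  (forall x v, x \in D -> v \in W -> br x v \in W) & \dim W = m].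
have [||_ [W [WD dW sW <-]] mx] := @ex_max_nat P (\dim D).
- exists 0%N, 0%VS; split; rewrite ?sub0v ?dimv0 //.
    by rewrite lt0n dimv_eq0.
  by move=> x y _; rewrite !memv0 => /eqP->; rewrite br0r.
- by move=> m [H' [_ lt _ <-]]; exact: ltnW.
have nDW : ~~ (D <= W)%VS by apply/negP => /dimvS; rewrite leqNgt dW.
have [//|v [vD vW vP]] := engel (leqnn _) sD nil WD nDW sW.
have DE : (W + <[v]>)%VS = D.
  apply/eqP; rewrite eqEdim subv_add WD -memvE vD /= leqNgt; apply/negP => lt.
  have /mx : P (\dim (W + <[v]>)); last first.
    rewrite leqNgt => /negP; apply; rewrite ltn_neqAle dimvS ?addvSl // andbT.
    apply: contra vW => dE; have /eqP-> : (W == W + <[v]>)%VS.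
      by rewrite eqEdim addvSl (eqP dE) leqnn.
    by apply: (subvP (addvSr _ _)); rewrite memv_line.
  exists (W + <[v]>)%VS; split=> //; first by rewrite subv_add WD -memvE vD.
  move=> x _ xD /memv_addP[a aW [_ /vlineP[b ->] ->]].
  apply: (subvP (addvSl _ _)); rewrite brDr brZr.
  by apply: rpredD; [exact: sW | apply/rpredZ/vP].
case/negP: nDW; apply: perf => x y xD; rewrite -{1}DE => /memv_addP[a aW [_ /vlineP[b ->] ->]].
rewrite brDr brZr; by apply: rpredD; [exact: sW | apply/rpredZ/vP].
Qed.
End LieBasics.

(** * Cartan's criterion *)

Section LfunExtra.
Variables (k : closedFieldType) (V : vectType k).
Implicit Types (f g h : 'End(V)) (u v : V).
Local Notation n := (\dim {:V}).

Lemma iter_lfunE f m v : iter m f v = (Hom (f2mx f ^+ m) : 'End(V)) v.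
Proof. by rewrite Hom_v2r -v2r_iter v2rK. Qed.

Lemma iter_lfunD f m u v : iter m f (u + v) = iter m f u + iter m f v.
Proof. by rewrite !iter_lfunE linearD. Qed.

Lemma iter_lfun_basis (b : seq V) f m : <<b>>%VS = fullv ->
  (forall v, v \in b -> iter m f v = 0) -> forall v, iter m f v = 0.
Proof.
move=> bf h v; rewrite iter_lfunE.
suff -> : (Hom (f2mx f ^+ m) : 'End(V)) = 0 by rewrite zero_lfunE.
by apply: (lfun_eq_on_span bf) => u /h; rewrite iter_lfunE zero_lfunE.
Qed.

Lemma jordan_parts f : exists s : 'End(V),
  [/\ forall r v, iter n (f - r *: \1%VF) v = 0 -> s v = r *: v,
      forall h, (f \o h = h \o f)%VF -> (s \o h = h \o s)%VF &
      forall v, iter n (f - s) v = 0].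
Proof.
have [s sr sc] := primary_lfun f id; exists s; split=> //.
have [b bb [l bl]] := generalized_eigenbasis f.
apply: (iter_lfun_basis (span_basis bb)) => v /(tnthP b)[i ->].
rewrite (tnth_nth 0) -[RHS](bl i).
have : forall m, iter m (f - s) b`_i = iter m (f - l i *: \1%VF) b`_i; last exact.
elim=> //= m ->; rewrite !add_lfunE !opp_lfunE scale_lfunE id_lfunE; congr (_ - _).
apply: sr; rewrite -iterD addnC iterD bl.
by rewrite iter_lfunE linear0.
Qed.

Lemma basis_ltr_diag (b : n.-tuple V) f (q : 'I_n -> k) : basis_of fullv b ->
  (forall i : 'I_n, f b`_i = q i *: b`_i) -> ltr f = \sum_i q i.
Proof.
move=> bb fq; rewrite (ltr_basis _ bb); apply: eq_bigr => i _.
by rewrite fq linearZ /= coord_free ?(basis_free bb) // eqxx mulr1.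
Qed.

Lemma lfun_eq_basis (b : n.-tuple V) f g : basis_of fullv b ->
  (forall i : 'I_n, f b`_i = g b`_i) -> f = g.
Proof.
move=> bb fg; apply: (lfun_eq_on_span (span_basis bb)) => v /(tnthP b)[i ->].
by rewrite (tnth_nth 0) fg.
Qed.
End LfunExtra.

Section Cartan.
Variables (k : closedFieldType) (V : vectType k) (br : V -> V -> V).
Hypothesis La : lie_algebra br.
Hypothesis ch0 : [pchar k] =i pred0.
Implicit Types (f g h : 'End(V)) (u v x y z : V).
Local Notation n := (\dim {:V}).
Local Notation ad := (ad br).
Local Notation killing := (killing br).

(** By Leibniz, [f - (r + s)] acts on a bracket as [f - r] on the left factor plus [f - s] on the
    right one. After [n + n] steps every term vanishes, and the exponent is then lowered to [n]. *)
Lemma derivation_generalized_eigen f r s u v : derivation br f ->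
  iter n (f - r *: \1%VF) u = 0 -> iter n (f - s *: \1%VF) v = 0 ->
  iter n (f - (r + s) *: \1%VF) (br u v) = 0.
Proof.
move=> df hu hv; apply: (@generalized_eigen_dim _ _ _ _ _ (n + n)).
have gen m1 m2 x y : iter m1 (f - r *: \1%VF) x = 0 -> iter m2 (f - s *: \1%VF) y = 0 ->
    iter (m1 + m2) (f - (r + s) *: \1%VF) (br x y) = 0; last exact: gen.
elim: m1 m2 x y => [|m1 IH1] m2 x y.
  by move=> /= -> _; rewrite (br0l La) iter_lfunE linear0.
elim: m2 x y => [|m2 IH2] x y hx hy.
  by have -> : y = 0 := hy; rewrite (br0r La) iter_lfunE linear0.
have -> : (m1.+1 + m2.+1 = (m1 + m2.+1).+1)%N by [].
rewrite iterSr.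
have -> : (f - (r + s) *: \1%VF) (br x y) =
    br ((f - r *: \1%VF) x) y + br x ((f - s *: \1%VF) y).
  rewrite !add_lfunE !opp_lfunE !scale_lfunE !id_lfunE df (brDl La) (brDr La).
  rewrite (brNl La) (brNr La) (brZl La) (brZr La) scalerDl opprD.
  by rewrite addrACA.
rewrite iter_lfunD IH1 -?iterSr // add0r.
by rewrite addnS -addSn IH2 // -iterSr.
Qed.

Lemma derivation_on_basis g (b : n.-tuple V) : basis_of fullv b ->
  (forall i j : 'I_n, g (br b`_i b`_j) = br (g b`_i) b`_j + br b`_i (g b`_j)) ->
  derivation br g.
Proof.
move=> bb gb.
have gbx (i : 'I_n) y : g (br b`_i y) = br (g b`_i) y + br b`_i (g y).
  have : (g \o ad b`_i)%VF = ad (g b`_i) + (ad b`_i \o g)%VF.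
    by apply: (lfun_eq_basis bb) => j; rewrite add_lfunE !comp_lfunE !(adE La) gb.
  by move/lfunP/(_ y); rewrite add_lfunE !comp_lfunE !(adE La).
move=> x y; have : (g \o ad y)%VF = ad (g y) + (ad y \o g)%VF.
  apply: (lfun_eq_basis bb) => i; rewrite add_lfunE !comp_lfunE !(adE La).
  by rewrite !(br_anti La _ b`_i) !(br_anti La _ (g b`_i)) (linearN g) /= gbx opprD addrC.
move/lfunP/(_ x); rewrite add_lfunE !comp_lfunE !(adE La) !(br_anti La _ x).
by rewrite (br_anti La _ (g x)) (linearN g) /= -opprD => /oppr_inj->; rewrite addrC.
Qed.

(** Additivity of [Q] is asked only where the sum of two eigenvalues is again an eigenvalue, which
    is the form in which an integral functional provides it. *)
Lemma primary_derivation f g (Q : k -> k) (b : n.-tuple V) (l : 'I_n -> k) :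
  derivation br f -> basis_of fullv b ->
  (forall i : 'I_n, iter n (f - l i *: \1%VF) b`_i = 0) ->
  (forall r v, iter n (f - r *: \1%VF) v = 0 -> g v = Q r *: v) ->
  (forall i j p, l p = l i + l j -> Q (l p) = Q (l i) + Q (l j)) ->
  derivation br g.
Proof.
move=> df bb bl gQ Qadd.
have gb (i j : 'I_n) : g (br b`_i b`_j) = br (g b`_i) b`_j + br b`_i (g b`_j).
  rewrite (gQ _ _ (bl i)) (gQ _ _ (bl j)) (brZl La) (brZr La) -scalerDl.
  have brij := derivation_generalized_eigen df (bl i) (bl j).
  have [/existsP[p /eqP lp]|/existsPn nl] := boolP [exists p, l p == l i + l j].
    by rewrite (gQ (l i + l j)) // -lp (Qadd i j).
  (* [l i + l j] is not an eigenvalue, so the bracket vanishes. *)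
  suff -> : br b`_i b`_j = 0 by rewrite linear0 scaler0.
  have [G GQ _] := primary_lfun f (fun r => (r == l i + l j)%:R).
  have G0 : G = 0.
    apply: (lfun_eq_basis bb) => p.
    by rewrite (GQ _ _ (bl p)) (negPf (nl p)) scale0r zero_lfunE.
  by have := GQ _ _ brij; rewrite G0 zero_lfunE eqxx scale1r.
exact: derivation_on_basis bb gb.
Qed.

(* The derivation with eigenvalues [q i] turns the hypothesis into the relation
   [\sum_i l i *~ q i = 0], whence [\sum_i q i ^ 2 = 0]. *)
Lemma ad_nilpotent_of_trace x :
  (forall g, derivation br g -> ltr (g \o ad x)%VF = 0) ->
  forall v, iter n (br x) v = 0.
Proof.
move=> tr0; set f := ad x.
have [b bb [l bl]] := generalized_eigenbasis f.
have [q [qrel qsep qn0]] := separating_int_functional (l : 'I_n -> k^o) ch0.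
have [q1 _ q3] := int_functional_additive qrel.
(* [q] turned into a function of the eigenvalue, well defined because equal [l i] have equal [q i];
   off the spectrum it defaults to 0. *)
pose Q r : k := if [pick i | l i == r] is Some i then (q i)%:~R else 0.
have Ql i : Q (l i) = (q i)%:~R.
  rewrite /Q; case: pickP => [j /eqP /q1 -> //|/(_ i)]; by rewrite eqxx.
have [g gQ gC] := primary_lfun f Q.
have [s [sl sC fs]] := jordan_parts f.
have gd : derivation br g.
  apply: (primary_derivation (ad_derivation La x) bb bl gQ) => i j p lp.
  by rewrite !Ql (q3 _ _ _ lp) rmorphD.
have gf : (g \o f = f \o g)%VF by apply: gC.
have gs : (g \o s = s \o g)%VF by rewrite (sC g).
have : ltr (g \o s)%VF = 0.
  have := tr0 g gd; rewrite -/f -[f](subrK s) comp_lfunDr ltrD.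
  rewrite (ltr_nilpotent_comm _ fs) ?add0r //.
  by rewrite comp_lfunDr comp_lfunDl comp_lfunNr comp_lfunNl gf gs.
rewrite (basis_ltr_diag (q := fun i => l i *~ q i) bb) => [/qrel qq|i]; last first.
  by rewrite comp_lfunE (sl _ _ (bl i)) linearZ /= (gQ _ _ (bl i)) Ql scalerA mulrzr.
have q0 i : q i = 0.
  apply/eqP; rewrite -sqrf_eq0 expr2; apply/eqP.
  apply: (Num.Theory.psumr_eq0P _ qq) => // j _; rewrite -expr2; exact: Num.Theory.sqr_ge0.
have l0 i : l i = 0.
  by apply/eqP; apply: contraT => /qn0; rewrite q0 eqxx.
move=> v; rewrite -(iter_ad La) -/f; move: v; apply: (iter_lfun_basis (span_basis bb)).
move=> v /(tnthP b)[i ->]; have := bl i; rewrite l0 scale0r subr0.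
by rewrite (tnth_nth 0).
Qed.

Lemma mem_derived (I : {vspace V}) u v : u \in I -> v \in I -> br u v \in derived br I.
Proof.
move=> /coord_vbasis-> /coord_vbasis->.
rewrite (br_suml La) memv_suml // => i _; rewrite (br_sumr La) memv_suml // => j _.
rewrite (brZl La) (brZr La) !memvZ // memv_span //.
by apply/allpairsP; exists ((vbasis I)`_i, (vbasis I)`_j); rewrite !mem_nth ?size_tuple.
Qed.

Lemma derived_sub (I W : {vspace V}) :
  (forall x y, x \in I -> y \in I -> br x y \in W) -> (derived br I <= W)%VS.
Proof.
move=> h; apply/span_subvP => _ /allpairsP[[u v] /= [ui vi ->]].
by apply: h; apply: vbasis_mem.
Qed.

Lemma derived_ideal (I : {vspace V}) : lie_ideal br I -> lie_ideal br (derived br I).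
Proof.
move=> hI y x xI.
have [||U UP] := @vspace_of_pred _ _ (fun x => br y x \in derived br I).
- by rewrite (br0r La) mem0v.
- by move=> a u v hu hv; rewrite (brPr La) rpredD ?rpredZ.
apply/UP; move: x xI; apply/subvP; apply: derived_sub => u v uI vI; apply/UP.
rewrite -(adE La) (ad_derivation La) !(adE La).
by rewrite rpredD ?mem_derived // hI.
Qed.

(** The radical [S] of the form is an ideal, so its solvability is enough. Its derived series
    stabilizes at a perfect [D m]. For a derivation [g] and [u], [v] in [D m],
    [tr (g \o ad (br u v)) = killing (g u) v], which is 0 since [v] is in [S]; hence [D m] consists
    of ad-nilpotent elements and is 0 by Engel. *)
Lemma killing_nondegenerate : semisimple_lie br ->
  forall x, (forall y, killing x y = 0) -> x = 0.
Proof.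
move=> [_ ss].
have [||S SP] := @vspace_of_pred _ _ (fun x => forall y, killing x y = 0).
- by move=> y; rewrite (killing0l La).
- by move=> a u v hu hv y; rewrite (killingPl La) hu hv mulr0 addr0.
suff S0 : S = 0%VS by move=> x /SP; rewrite S0 memv0 => /eqP.
have idS : lie_ideal br S.
  move=> x y /SP yS; apply/SP => z.
  by rewrite (br_anti La) (killingNl La) (killing_inv La) yS oppr0.
apply: ss => //; pose D m := iter m (derived br) S.
have idD m : lie_ideal br (D m) by elim: m => [|m IH]; [exact: idS | exact: derived_ideal IH].
have DS m : (D m.+1 <= D m)%VS.
  by apply: derived_sub => x y _; apply: idD.
have DS0 m : (D m <= S)%VS by elim: m => [|m IH]; [exact: subvv | exact: subv_trans (DS m) IH].
have [m Dm] : exists m, D m.+1 = D m.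
  apply: NNPP => no.
  have lt m : (\dim (D m) + m <= \dim S)%N.
    elim: m => [|m IH]; first by rewrite addn0.
    rewrite addnS (leq_trans _ IH) // -addSn leq_add2r ltn_neqAle dimvS // andbT.
    apply/negP => dE; apply: no; exists m; apply/eqP.
    by rewrite eqEdim DS (eqP dE) leqnn.
  by have := lt (\dim S).+1; rewrite addnS ltnNge leq_addl.
exists m; apply: (engel_perfect La) => [x y _|x v xD|W WP]; first exact: idD.
  move: v; apply: ad_nilpotent_of_trace => g gd; move: xD; rewrite -/(D m) -Dm.
  have [||U UP] := @vspace_of_pred _ _ (fun x => ltr (g \o ad x)%VF = 0).
  - by rewrite -(scale0r 0) (adZ La) scale0r comp_lfun0r -(scale0r 0) ltrZ mul0r.
  - move=> a y z hy hz.
    by rewrite (adP La) comp_lfunDr -comp_lfunZr ltrD ltrZ hy hz mulr0 addr0.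
  move=> xD; apply/UP; move: x xD; apply/subvP/derived_sub => u v uD vD; apply/UP.
  rewrite (ad_br La) -ltr_commutator -(derivation_ad La) //.
  by rewrite -[LHS]/(killing (g u) v) killingC; have /SP-> := subvP (DS0 m) _ vD.
by rewrite -/(D m) -Dm; apply: derived_sub.
Qed.
End Cartan.

(** * Jordan decomposition *)

Section Semisimple.
Variables (k : closedFieldType) (V : vectType k) (br : V -> V -> V).
Hypothesis La : lie_algebra br.
Hypothesis ch0 : [pchar k] =i pred0.
Implicit Types (f g h : 'End(V)) (u v x y z : V).
Local Notation n := (\dim {:V}).
Local Notation ad := (ad br).
Local Notation killing := (killing br).
Hypothesis nd : forall x, (forall y, killing x y = 0) -> x = 0.

Lemma ad_inj x y : ad x = ad y -> x = y.
Proof.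
move=> xy; apply/eqP; rewrite -subr_eq0; apply/eqP/nd => z.
rewrite /killing (adD La) (adN La) xy subrr comp_lfun0l.
by rewrite -(scale0r 0) ltrZ mul0r.
Qed.

Lemma killing_riesz (l : V -> k) : (forall a x y, l (a *: x + y) = a * l x + l y) ->
  exists x, forall y, killing x y = l y.
Proof.
move=> lP; pose e i : V := r2v (delta_mx 0 i).
have l0 : l 0 = 0.
  by have := lP (-1) 0 0; rewrite scaler0 addr0 mulN1r addNr.
have eE y : y = \sum_i v2r y 0 i *: e i.
  by rewrite -{1}[y]v2rK {1}[v2r y]row_sum_delta linear_sum; apply: eq_bigr => i _; rewrite linearZ.
have lsum (m : V -> k) : (forall a x y, m (a *: x + y) = a * m x + m y) -> m 0 = 0 ->
    forall y, m y = \sum_i v2r y 0 i * m (e i).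
  move=> mP m0 y; rewrite {1}[y]eE; elim/big_rec2: _ => [//|i a b _ <-]; exact: mP.
pose K : 'M[k]_(dim V) := \matrix_(i, j) killing (e i) (e j).
have KE x j : (v2r x *m K) 0 j = killing x (e j).
  rewrite mxE (lsum (fun x => killing x (e j))) ?(killing0l La) // => [|a y z]; last exact: killingPl.
  by apply: eq_bigr => i _; rewrite mxE.
have Ku : K \in unitmx.
  rewrite -row_free_unit -kermx_eq0; apply/eqP/row_matrixP => i; rewrite row0.
  rewrite -[LHS]r2vK; apply/eqP; rewrite (can2_eq v2rK r2vK) linear0.
  apply/eqP/nd => y; rewrite (lsum (killing _)); last first.
  - by rewrite killingC killing0l.
  - by move=> a u v; rewrite (killingDr La) (killingZr La).
  by apply: big1 => j _; rewrite -KE r2vK -row_mul mulmx_ker row0 mxE mulr0.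
exists (r2v ((\row_j l (e j)) *m invmx K)) => y.
rewrite (lsum (killing _)); last first.
- by rewrite killingC killing0l.
- by move=> a u v; rewrite (killingDr La) (killingZr La).
rewrite (lsum l) //; apply: eq_bigr => j _.
by rewrite -KE r2vK mulmxKV // mxE.
Qed.

(** Let [x] represent the functional [tr (f \o ad y)]; invariance shows that [f y - br x y] is
    orthogonal to everything. *)
Lemma derivation_inner f : derivation br f -> exists x, f = ad x.
Proof.
move=> df; have [|x xP] := @killing_riesz (fun y => ltr (f \o ad y)%VF).
  by move=> a y z; rewrite (adP La) comp_lfunDr -comp_lfunZr ltrD ltrZ.
exists x; apply/lfunP => y; rewrite (adE La); apply/eqP; rewrite -subr_eq0; apply/eqP/nd => z.
rewrite (killingDl La) (killingNl La) (killing_inv La) xP.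
by rewrite /killing (derivation_ad La) // (ad_br La) ltr_commutator subrr.
Qed.

(** The semisimple part of [ad x] has additive eigenvalues, hence is a derivation, hence is inner:
    the Jordan decomposition of [ad x] is realized inside the algebra. *)
Lemma jordan_ad x : exists s : V,
  [/\ diagonal_lfun (ad s), forall h, (ad x \o h = h \o ad x)%VF -> (ad s \o h = h \o ad s)%VF,
      forall v, iter n (ad (x - s)) v = 0 &
      forall r v, iter n (ad x - r *: \1%VF) v = 0 -> br s v = r *: v].
Proof.
have [f [fr fC fn]] := jordan_parts (ad x).
have [b bb [l bl]] := generalized_eigenbasis (ad x).
have df : derivation br f.
  exact: (primary_derivation La (Q := id) (ad_derivation La x) bb bl fr).
have [s fE] := derivation_inner df; rewrite {f df}fE in fr fC fn.
exists s; split=> // [|v|r v /fr]; last by rewrite (adE La).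
  exists b; split; first exact: span_basis bb.
  by move=> v /(tnthP b)[i ->]; exists (l i); rewrite (tnth_nth 0) (fr _ _ (bl i)).
by rewrite (adD La) (adN La).
Qed.

Lemma ad_semisimpleP x : ad_semisimple br x <-> diagonal_lfun (ad x).
Proof.
by split=> -[b [bf bP]]; exists b; split=> // v /bP[c]; rewrite (adE La) => vc; exists c.
Qed.

Definition lie_morphism f := forall x y, f (br x y) = br (f x) (f y).

Lemma ad_morphism f x : lie_morphism f -> (f \o ad x = ad (f x) \o f)%VF.
Proof. by move=> fm; apply/lfunP => y; rewrite !comp_lfunE !(adE La) fm. Qed.

Lemma killing_morphism f x y : lie_morphism f -> lker f == 0%VS ->
  killing (f x) (f y) = killing x y.
Proof.
move=> fm f0.
have adf z : ad (f z) = (f \o ad z \o f^-1)%VF.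
  by rewrite ad_morphism // lker0_compfK.
rewrite /killing !adf !comp_lfunA lker0_compfVK // ltrC !comp_lfunA.
by rewrite lker0_compVf // comp_lfun1l.
Qed.

Lemma involution_lker0 f : (forall x, f (f x) = x) -> lker f == 0%VS.
Proof. by move=> ff; apply/lker0P => x y /(congr1 f); rewrite !ff. Qed.

(** [f] exchanges the generalized eigenspaces of [ad x] for [l] and [- l], so conjugation by [f]
    negates the semisimple part. *)
Lemma jordan_anti f x s : lie_morphism f -> (forall x, f (f x) = x) -> f x = - x ->
  (forall r v, iter n (ad x - r *: \1%VF) v = 0 -> br s v = r *: v) -> f s = - s.
Proof.
move=> fm ff fx sP; apply: ad_inj.
have [b bb [l bl]] := generalized_eigenbasis (ad x).
apply: (lfun_eq_basis bb) => i; rewrite !(adE La) (brNl La) (sP _ _ (bl i)).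
have fb : br s (f b`_i) = - l i *: f b`_i.
  apply: sP.
  have : forall m, iter m (ad x - - l i *: \1%VF) (f b`_i) =
      (-1) ^+ m *: f (iter m (ad x - l i *: \1%VF) b`_i).
    elim=> [|m /= ->]; first by rewrite scale1r.
    rewrite linearZ /= exprSr -scalerA; congr (_ *: _); set w := iter m _ _.
    have brf : br x (f w) = - f (br x w).
      by rewrite -[in LHS](ff x) -fm fx (brNl La) linearN.
    rewrite !add_lfunE !opp_lfunE !scale_lfunE !id_lfunE !(adE La) brf.
    by rewrite scaleN1r scaleNr opprK linearB /= opprB [in RHS]linearZ /= addrC.
  by move=> ->; rewrite bl linear0 scaler0.
by rewrite -[b`_i in LHS]ff -fm fb linearZ /= ff scaleNr.
Qed.
End Semisimple.

(** * Cartan subspaces *)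

Section Weights.
Variables (k : closedFieldType) (V : vectType k).
Local Notation n := (\dim {:V}).

Lemma linear_lfun (F : V -> V) : (forall a u v, F (a *: u + v) = a *: F u + F v) ->
  exists f : 'End(V), f =1 F.
Proof.
move=> lin; pose FL : {linear V -> V} := HB.pack F (GRing.isLinear.Build k V V *:%R F lin).
by exists (linfun FL) => v; rewrite lfunE.
Qed.

(** The conclusion concerns any vector supported where [q] equals [r], so that it applies directly
    to brackets and images of basis vectors. *)
Lemma diagonal_on_basis (b : n.-tuple V) (q : 'I_n -> k) : basis_of fullv b ->
  exists f : 'End(V), forall r v,
    (forall p, coord b p v != 0 -> q p = r) -> f v = r *: v.
Proof.
move=> bb; have [|f fE] := @linear_lfun (fun v => \sum_p coord b p v *: (q p *: b`_p)).
  move=> a u v; rewrite scaler_sumr -big_split; apply: eq_bigr => p _ /=.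
  by rewrite linearP /= scalerDl -scalerA.
exists f => r v h; rewrite fE {2}(coord_basis bb (memvf v)) scaler_sumr.
apply: eq_bigr => p _; have [->|/h->] := eqVneq (coord b p v) 0.
  by rewrite !scale0r scaler0.
by rewrite scalerA mulrC -scalerA.
Qed.

Lemma coord_eigen (b : n.-tuple V) (f : 'End(V)) (w : 'I_n -> k) r v p : basis_of fullv b ->
  (forall i : 'I_n, f b`_i = w i *: b`_i) -> f v = r *: v -> coord b p v != 0 -> w p = r.
Proof.
move=> bb fb fv vp; apply: (mulIf vp).
have <- : coord b p (f v) = r * coord b p v by rewrite fv linearZ.
rewrite [v in RHS](coord_basis bb (memvf v)) !linear_sum (bigD1 p) //= !linearZ /= fb linearZ /= coord_free ?(basis_free bb) //.
rewrite eqxx mulr1 big1 ?addr0 1?mulrC // => i ip.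
by rewrite !linearZ /= fb linearZ /= coord_free ?(basis_free bb) // (negPf ip) !mulr0.
Qed.
End Weights.

Section CartanSubspace.
Variables (k : closedFieldType) (V : vectType k) (br : V -> V -> V).
Hypothesis La : lie_algebra br.
Hypothesis ch0 : [pchar k] =i pred0.
Implicit Types (f g h : 'End(V)) (u v x y z : V) (c : {vspace V}).
Local Notation n := (\dim {:V}).
Local Notation ad := (ad br).
Local Notation killing := (killing br).
Hypothesis nd : forall x, (forall y, killing x y = 0) -> x = 0.

(** [w i] is the weight of the basis vector [i], a linear form on [c] written by its values on
    [vbasis c]; as row vectors, weights are open to the integral functionals. *)
Lemma common_eigenbasis c : comm_semisimple br c ->
  exists2 b : n.-tuple V, basis_of fullv b &
    exists w : 'I_n -> 'rV[k]_(\dim c),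
      forall (i : 'I_n) (j : 'I_(\dim c)), br (vbasis c)`_j b`_i = w i 0 j *: b`_i.
Proof.
move=> [cc cs]; have [||b bb bP] := @codiagonalization _ _ [seq ad z | z <- vbasis c].
- move=> _ _ /mapP[z /vbasis_mem zc ->] /mapP[y /vbasis_mem yc ->].
  apply/eqP; rewrite -subr_eq0 -(ad_br La) cc //; apply/eqP/lfunP => v.
  by rewrite (adE La) (br0l La) zero_lfunE.
- by move=> _ /mapP[z /vbasis_mem zc ->]; apply/(ad_semisimpleP La)/cs.
exists b => //.
have ex (i : 'I_n) (j : 'I_(\dim c)) : exists a : k, br (vbasis c)`_j b`_i == a *: b`_i.
  have [|a aE] := bP (ad (vbasis c)`_j) _ i.
    by apply/map_f/mem_nth; rewrite size_tuple.
  by exists a; rewrite -(adE La) aE.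
exists (fun i => \row_j xchoose (ex i j)) => i j.
by rewrite mxE; apply/eqP/(xchooseP (ex i j)).
Qed.

Section TwoInvolutions.
Variables s1 s2 : 'End(V).
Hypotheses (m1 : lie_morphism br s1) (m2 : lie_morphism br s2).
Hypotheses (i1 : forall x, s1 (s1 x) = x) (i2 : forall x, s2 (s2 x) = x).
Hypothesis s12 : forall x, s1 (s2 x) = s2 (s1 x).

(** With [s1 = s2] this is the (-1)-eigenspace of a single involution, so the same results serve
    both [c] and the Cartan subspace [a] of the larger eigenspace. *)
Definition anti x := s1 x = - x /\ s2 x = - x.

Lemma natr_neq0 m : (m.+1%:R : k) != 0.
Proof. by rewrite ((pcharf0P _).1 ch0). Qed.

(** As [x] centralizes [c], it is orthogonal to all vectors of nonzero weight. A vector of weight 0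
    may be replaced by its image under [1 - s1] and then [1 - s2], each doubling the pairing with
    [x], and the result lies in the centralizer of [c] among the [anti] vectors. *)
Lemma killing_anti_centralizer c x : comm_semisimple br c -> (forall z, z \in c -> anti z) ->
  anti x -> (forall z, z \in c -> br z x = 0) ->
  (forall y, anti y -> (forall z, z \in c -> br z y = 0) -> killing x y = 0) -> x = 0.
Proof.
move=> cs ca [x1 x2] cx kx; apply: nd.
have [b bb [w bw]] := common_eigenbasis cs.
have proj s y : lie_morphism br s -> (forall u, s (s u) = u) -> s x = - x ->
    (forall z, z \in c -> s z = - z) -> (forall z, z \in c -> br z y = 0) ->
    killing x (y - s y) = 2%:R * killing x y /\ forall z, z \in c -> br z (y - s y) = 0.
  move=> sm ss sx sc cy; split.
    rewrite (killingDr La) (killingNr La) -{2}[x]opprK -sx (killingNl La) opprK.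
    by rewrite (killing_morphism La) ?involution_lker0 // mulr_natl mulr2n.
  move=> z zc; rewrite (brDr La) (brNr La) cy // -[z in br z (s y)]ss -sm (sc z zc).
  by rewrite (brNl La) cy // oppr0 linear0 subr0.
have kc y : (forall z, z \in c -> br z y = 0) -> killing x y = 0.
  move=> cy.
  have [k1 c1] := proj s1 y m1 i1 x1 (fun z zc => (ca z zc).1) cy.
  have [k2 c2] := proj s2 _ m2 i2 x2 (fun z zc => (ca z zc).2) c1.
  have : killing x (y - s1 y - s2 (y - s1 y)) = 0.
    apply: kx => //; split; last by rewrite linearB /= i2 [RHS]opprB.
    have sA : s1 (y - s1 y) = - (y - s1 y) by rewrite (linearB s1) /= i1 [RHS]opprB.
    by rewrite (linearB s1) /= s12 sA (linearN s2) /= [RHS]opprD.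
  rewrite k2 k1 => /eqP; rewrite !mulf_eq0 -[2%:R]/(1.+1%:R) (negPf (natr_neq0 1)) /=.
  by move/eqP.
have kb (i : 'I_n) : killing x b`_i = 0.
  have [w0|/rV0Pn[j wij]] := eqVneq (w i) 0.
    apply: kc => z /coord_vbasis->; rewrite (br_suml La) big1 // => j _.
    by rewrite (brZl La) bw w0 mxE scale0r scaler0.
  have zc : (vbasis c)`_j \in c by apply/vbasis_mem/mem_nth; rewrite size_tuple.
  apply: (mulfI wij); rewrite mulr0 -(killingZr La) -bw -(killing_inv La).
  by rewrite (br_anti La) cx // oppr0 (killing0l La).
move=> y; have [||U UP] := @vspace_of_pred _ _ (fun y => killing x y = 0).
- by rewrite killingC (killing0l La).
- by move=> a u v hu hv; rewrite (killingDr La) (killingZr La) hu hv mulr0 addr0.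
apply/UP; have : (<<b>> <= U)%VS.
  by apply/span_subvP => v /(tnthP b)[i ->]; apply/UP; rewrite (tnth_nth 0) kb.
by rewrite (span_basis bb) => /subvP; apply; exact: memvf.
Qed.

Lemma diagonal_lfun_comm f g a : (f \o g = g \o f)%VF ->
  diagonal_lfun f -> diagonal_lfun g -> diagonal_lfun (f + a *: g).
Proof.
move=> fg df dg; have [||b bb bP] := @codiagonalization _ _ [:: f; g].
- by move=> f' g'; rewrite !inE => /orP[]/eqP-> /orP[]/eqP->.
- by move=> f'; rewrite !inE => /orP[]/eqP->.
exists b; split; first exact: span_basis bb.
move=> v /(tnthP b)[i ->]; rewrite (tnth_nth 0).
have [|l lE] := bP f _ i; first by rewrite inE eqxx.
have [|m mE] := bP g _ i; first by rewrite !inE eqxx orbT.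
by exists (l + a * m); rewrite add_lfunE scale_lfunE lE mE scalerA -scalerDl.
Qed.

Lemma ltr_ad_comm_nilpotent x y : br x y = 0 -> (forall v, iter n (ad y) v = 0) ->
  killing x y = 0.
Proof.
move=> xy yn; apply: (ltr_nilpotent_comm _ yn).
apply/eqP; rewrite -subr_eq0 -(ad_br La) xy; apply/eqP/lfunP => v.
by rewrite (adE La) (br0l La) zero_lfunE.
Qed.

(* In the centralizer, the semisimple part of any element lies in [c] by
   maximality; the orthogonal of [c] therefore consists of nilpotent elements, on
   which the Killing form vanishes by polarization. *)
Lemma cartan_centralizer c : cartan_subspace br anti c ->
  forall x, anti x -> (forall z, z \in c -> br z x = 0) -> x \in c.
Proof.
move=> [ca [cc cs] cmax].
pose Z x := anti x /\ forall z, z \in c -> br z x = 0.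
have cZ s : s \in c -> Z s by move=> sc; split=> [|z zc]; [exact: ca | exact: cc].
have ZP a x y : Z x -> Z y -> Z (a *: x + y).
  move=> [[x1 x2] xc] [[y1 y2] yc]; split.
    by split; rewrite linearP /= ?x1 ?x2 ?y1 ?y2 scalerN opprD.
  by move=> z zc; rewrite (brPr La) xc // yc // scaler0 addr0.
have nilc z x : z \in c -> Z x -> (forall v, iter n (ad x) v = 0) -> killing z x = 0.
  by move=> zc [_ xc]; apply: ltr_ad_comm_nilpotent; apply: xc.
have jd x : Z x -> exists2 s, s \in c & Z (x - s) /\ forall v, iter n (ad (x - s)) v = 0.
  move=> Zx; have [[x1 x2] xc] := Zx; have [s [sd sC sn sr]] := jordan_ad La nd x.
  have sA : anti s by split; [exact: (jordan_anti La nd m1 i1 x1) | exact: (jordan_anti La nd m2 i2 x2)].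
  have adC z y : br z y = 0 -> (ad y \o ad z = ad z \o ad y)%VF.
    move=> zy; apply/esym/eqP; rewrite -subr_eq0 -(ad_br La) zy; apply/eqP/lfunP => v.
    by rewrite (adE La) (br0l La) zero_lfunE.
  have sc z : z \in c -> br z s = 0.
    move=> zc; apply: (ad_inj La nd); rewrite (ad_br La) sC ?subrr; last exact/adC/xc.
    by apply/lfunP => v; rewrite (adE La) (br0l La) zero_lfunE.
  suff sin : s \in c.
    exists s => //; split=> //.
    by have -> : x - s = -1 *: s + x; [rewrite scaleN1r addrC | exact: ZP (cZ _ sin) Zx].
  suff <- : (c + <[s]>)%VS = c by apply: (subvP (addvSr _ _)); rewrite memv_line.
  apply: cmax; first exact: addvSl.
    move=> _ /memv_addP[z zc [_ /vlineP[a ->] ->]]; have [z1 z2] := ca z zc.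
    by split; rewrite linearD linearZ /= ?sA.1 ?sA.2 ?z1 ?z2 scalerN opprD.
  split.
    move=> _ _ /memv_addP[z zc [_ /vlineP[a ->] ->]] /memv_addP[y yc [_ /vlineP[e ->] ->]].
    rewrite (brDl La) !(brDr La) !(brZl La) !(brZr La) (brxx La) cc // sc //.
    by rewrite (br_anti La s) sc // oppr0 !scaler0 !addr0.
  move=> _ /memv_addP[z zc [_ /vlineP[a ->] ->]]; apply/(ad_semisimpleP La).
  rewrite (adD La) (adZ La); apply: diagonal_lfun_comm => //; first exact/esym/adC/sc.
  by apply/(ad_semisimpleP La)/cs.
(* The Killing form is nondegenerate on [c]: an element of the centralizer differs from one of [c]
   by a nilpotent element, which is orthogonal to [c]. *)
have cnd s : s \in c -> (forall z, z \in c -> killing s z = 0) -> s = 0.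
  move=> sc ks; apply: (killing_anti_centralizer (conj cc cs)) => //; first exact: ca.
  - by move=> z zc; apply: cc.
  - move=> y yA yc; have [t tc [Zt tn]] := jd y (conj yA yc).
    by rewrite -(subrK t y) (killingDr La) nilc // ks // addr0.
have perp x : Z x -> (forall z, z \in c -> killing z x = 0) -> forall v, iter n (ad x) v = 0.
  move=> Zx kx; have [s sc [Zs sn]] := jd x Zx.
  suff s0 : s = 0 by rewrite s0 subr0 in sn.
  apply: cnd => // z zc; have := kx z zc.
  by rewrite -{1}(subrK s x) (killingDr La) nilc // add0r killingC.
have perp0 x : Z x -> (forall z, z \in c -> killing z x = 0) -> killing x x = 0.
  by move=> Zx kx; apply: ltr_ad_comm_nilpotent; [exact: brxx | exact: perp].
have perp2 x y : Z x -> Z y -> (forall z, z \in c -> killing z x = 0) ->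
    (forall z, z \in c -> killing z y = 0) -> killing x y = 0.
  move=> Zx Zy kx ky; have : killing (x + y) (x + y) = 0.
    apply: perp0 => [|z zc]; last by rewrite (killingDr La) kx // ky // addr0.
    by rewrite -[x]scale1r; apply: ZP.
  rewrite (killingDl La) !(killingDr La) !perp0 // add0r addr0 (killingC br y x) -mulr2n -mulr_natl.
  by move/eqP; rewrite mulf_eq0 -[2%:R]/(1.+1%:R) (negPf (natr_neq0 1)) /= => /eqP.
move=> x xA xc; have [s sc [Zs sn]] := jd x (conj xA xc).
suff xs : x - s = 0 by move/eqP: xs; rewrite subr_eq0 => /eqP->.
apply: (killing_anti_centralizer (conj cc cs)) => //; [exact: Zs.1 | exact: Zs.2 |].
move=> y yA yc; have [t tc [Zt tn]] := jd y (conj yA yc).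
rewrite -(subrK t y) (killingDr La) [X in _ + X]killingC (nilc t (x - s)) // addr0.
by apply: perp2 => // z zc; apply: nilc.
Qed.
End TwoInvolutions.
End CartanSubspace.

Section IntegralRegular.
Variables (k : closedFieldType) (V : vectType k) (br : V -> V -> V).
Hypothesis La : lie_algebra br.
Hypothesis ch0 : [pchar k] =i pred0.
Local Notation n := (\dim {:V}).
Local Notation ad := (ad br).
Local Notation killing := (killing br).
Hypothesis nd : forall x, (forall y, killing x y = 0) -> x = 0.
Variables s1 s2 : 'End(V).
Hypotheses (m1 : lie_morphism br s1) (m2 : lie_morphism br s2).
Hypotheses (i1 : forall x, s1 (s1 x) = x) (i2 : forall x, s2 (s2 x) = x).
Hypothesis s12 : forall x, s1 (s2 x) = s2 (s1 x).

(* [x] is a generic rational point of [c]. *)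
Lemma integral_regular_element (c : {vspace V}) : cartan_subspace br (anti s1 s2) c ->
  exists x (b : n.-tuple V) (q : 'I_n -> int) (wt : 'I_n -> V -> k),
    [/\ x \in c, basis_of fullv b,
        forall i : 'I_n, br x b`_i = (q i)%:~R *: b`_i,
        forall z, z \in c -> forall i : 'I_n, br z b`_i = wt i z *: b`_i &
        forall z i, z \in c ->
          (q i = 0 -> wt i z = 0) /\ (forall j, q i = q j -> wt i z = wt j z)].
Proof.
move=> cP; have [ca cs _] := cP; have [b bb [w bw]] := common_eigenbasis La cs.
have [q [qrel qsep qn0]] := separating_int_functional w ch0.
have [q1 q2 q3] := int_functional_additive qrel.
have zc j : (j < \dim c)%N -> (vbasis c)`_j \in c.
  by move=> jc; apply/vbasis_mem/mem_nth; rewrite size_tuple.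
have wE v (r : 'rV[k]_(\dim c)) p :
    (forall j : 'I_(\dim c), br (vbasis c)`_j v = r 0 j *: v) -> coord b p v != 0 -> w p = r.
  move=> vr vp; apply/rowP => j.
  apply: (@coord_eigen _ _ b (ad (vbasis c)`_j) (fun i => w i 0 j) _ v p bb) => // [i|].
    by rewrite (adE La) bw.
  by rewrite (adE La) vr.
have [D DP] := @diagonal_on_basis _ _ b (fun i => (q i)%:~R) bb.
have Db (i : 'I_n) : D b`_i = (q i)%:~R *: b`_i.
  apply: DP => p; rewrite coord_free ?(basis_free bb) //.
  by have [->|] := eqVneq i p; rewrite ?eqxx.
have dD : derivation br D.
  apply: (derivation_on_basis La bb) => i j.
  rewrite !Db (brZl La) (brZr La) -scalerDl; apply: DP => p vp.
  rewrite -rmorphD; congr (_%:~R); apply: q3; apply: wE vp => l.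
  rewrite -(adE La) (ad_derivation La) !(adE La) !bw (brZl La) (brZr La) -scalerDl.
  by rewrite mxE.
have [x xD] := derivation_inner La nd dD.
have bx (i : 'I_n) : br x b`_i = (q i)%:~R *: b`_i by rewrite -(adE La) -xD Db.
have xc z : z \in c -> br z x = 0.
  move=> /coord_vbasis->; rewrite (br_suml La) big1 // => j _; rewrite (brZl La).
  suff -> : br (vbasis c)`_j x = 0 by rewrite scaler0.
  apply: (ad_inj La nd); apply: (lfun_eq_basis bb) => i.
  rewrite !(adE La) (br0l La) (br_jacobi La) bx bw (brZr La) (brZr La) bx bw.
  by rewrite !scalerA mulrC subrr.
(* [s] negates weights, so each component of the image under [s] of basis vector [i] has [q]-value
   [- q i]. Thus [s] anticommutes with [D], which is [ad x]. *)
have anti_x s : lie_morphism br s -> (forall y, s (s y) = y) ->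
    (forall z, z \in c -> s z = - z) -> s x = - x.
  move=> sm ss sc; apply: (ad_inj La nd); apply: (lfun_eq_basis bb) => i.
  rewrite !(adE La) (brNl La) bx.
  have Ds : D (s b`_i) = - (q i)%:~R *: s b`_i.
    apply: DP => p vp; rewrite -rmorphN; congr (_%:~R); apply: q2; apply: wE vp => j.
    rewrite -[(vbasis c)`_j]ss -sm (sc _ (zc j (ltn_ord j))) (brNl La) bw linearN linearZ /= mxE.
    by rewrite scaleNr.
  by rewrite -[b`_i in LHS]ss -sm -(adE La) -xD Ds linearZ /= ss scaleNr.
exists x, b, q, (fun i z => \sum_j coord (vbasis c) j z * w i 0 j); split=> //.
- apply: (cartan_centralizer La ch0 nd m1 m2 i1 i2 s12 cP) => //; split.
    by apply: anti_x => // z /ca[].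
  by apply: anti_x => // z /ca[].
- move=> z zin i; rewrite {1}(coord_vbasis zin) (br_suml La) scaler_suml.
  by apply: eq_bigr => j _; rewrite (brZl La) bw scalerA.
- move=> z i zin; split=> [qi|j qij].
    have w0 : w i = 0 by apply/eqP; apply: contraT => /qn0; rewrite qi eqxx.
    by apply: big1 => j _; rewrite w0 mxE mulr0.
  have wij : w i = w j by apply/eqP; apply: contraT => /qsep; rewrite qij eqxx.
  by rewrite wij.
Qed.
End IntegralRegular.

(** * Exponentials of nilpotent elements *)

Section Exponential.
Variables (k : closedFieldType) (V : vectType k) (br : V -> V -> V).
Hypothesis La : lie_algebra br.
Hypothesis ch0 : [pchar k] =i pred0.
Local Notation n := (\dim {:V}).
Local Notation ad := (ad br).

(** The Cauchy product of two sums truncated at [N]: the vanishing of [a] beyond [N] allows the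
    antidiagonals to run up to [N + N]. *)
Lemma triangle_sum (N : nat) (a : nat -> nat -> V) :
  (forall i j, (N <= i)%N \/ (N <= j)%N -> a i j = 0) ->
  \sum_(m < N + N) \sum_(i < m.+1) a i (m - i)%N = \sum_(i < N) \sum_(j < N) a i j.
Proof.
move=> a0.
transitivity (\sum_(m < N + N) \sum_(i < N + N | (i <= m)%N) a i (m - i)%N).
  apply: eq_bigr => m _.
  by rewrite (big_ord_widen_cond (N + N) predT (fun i => a i (m - i)%N)) //.
rewrite (exchange_big_dep predT) //= big_split_ord /= [X in _ + X]big1 ?addr0; last first.
  by move=> i _; apply: big1 => m _; apply: a0; left; exact: leq_addr.
apply: eq_bigr => i _.
rewrite -(big_geq_mkord _ _ predT (fun m => a i (m - i)%N)).
rewrite -{1}[nat_of_ord i]add0n big_addn.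
under eq_bigr => j _ do rewrite addnK.
rewrite (@big_cat_nat _ _ _ N) //=; last by rewrite -addnBA ?leq_addr // ltnW.
rewrite big_mkord [X in _ + X]big_nat_cond [X in _ + X]big1 ?addr0 // => j /andP[/andP[Nj _] _].
by apply: a0; right.
Qed.

Lemma factS_inv m : ((m.+1)`!%:R : k)^-1 * m.+1%:R = (m`!%:R)^-1.
Proof.
have nz p : (p.+1%:R : k) != 0 by rewrite ((pcharf0P _).1 ch0).
by rewrite factS natrM invfM mulrAC mulVf // mul1r.
Qed.

Variable x : V.
Hypothesis xnil : ad_nilpotent br x.
Local Notation e i y := ((i`!%:R : k)^-1 *: iter i (br x) y).

Lemma divided_power_step i y : br x (e i y) = i.+1%:R *: e i.+1 y.
Proof.
by rewrite (brZr La) -iterS scalerA [_ * (_ ^-1)]mulrC factS_inv.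
Qed.

(** Applying [br x] multiplies the term of index [i] by [i] from one factor and by [m.+1 - i] from
    the other; their sum [m.+1] is cancelled in characteristic 0. *)
Lemma divided_power_leibniz m y z :
  e m (br y z) = \sum_(i < m.+1) br (e i y) (e (m - i)%N z).
Proof.
have nz p : (p.+1%:R : k) != 0 by rewrite ((pcharf0P _).1 ch0).
elim: m => [|m IH].
  by rewrite big_ord_recl big_ord0 addr0 /= fact0 invr1 !scale1r.
apply: (scalerI (nz m)); rewrite -divided_power_step IH (br_sumr La).
pose a i := br (e i y) (e (m.+1 - i)%N z).
transitivity (\sum_(i < m.+1) (i.+1%:R *: a i.+1) + \sum_(i < m.+1) ((m.+1 - i)%:R *: a i)).
  rewrite -big_split; apply: eq_bigr => i _ /=.
  rewrite -(adE La x) (ad_derivation La) !(adE La) !divided_power_step.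
  have im : (i <= m)%N by rewrite -ltnS.
  rewrite /a subSS (subSn im); congr (_ + _); first exact: (brZl La).
  exact: (brZr La).
rewrite scaler_sumr -[RHS]/(\sum_(i < m.+2) m.+1%:R *: a i).
transitivity (\sum_(i < m.+2) i%:R *: a i + \sum_(i < m.+2) (m.+1 - i)%:R *: a i).
  congr (_ + _); first by rewrite [RHS]big_ord_recl scale0r add0r.
  by rewrite [RHS]big_ord_recr /= subnn scale0r addr0.
rewrite -big_split; apply: eq_bigr => i _ /=.
by rewrite -scalerDl -natrD subnKC // -ltnS.
Qed.

Lemma divided_power0 i y : (n < i)%N -> e i y = 0.
Proof.
move=> ni; rewrite -(subnK (ltnW ni)) iterD xnil.
by rewrite -(iter_ad La) iter_lfunE linear0 scaler0.
Qed.

Lemma exp_ad_morphism y z : exp_ad br x (br y z) = br (exp_ad br x y) (exp_ad br x z).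
Proof.
rewrite /exp_ad (br_suml La).
under [RHS]eq_bigr => i _ do rewrite (br_sumr La).
rewrite -(@triangle_sum n.+1 (fun i j => br (e i y) (e j z))); last first.
  move=> i j [] h; first by rewrite divided_power0 // (br0l La).
  by rewrite (divided_power0 z) // (br0r La).
under [RHS]eq_bigr => m _ do rewrite -divided_power_leibniz.
rewrite big_split_ord /= [X in _ = _ + X]big1 ?addr0 // => i _.
by apply: divided_power0; rewrite ltnS leq_addr.
Qed.

(** If [m.+1] is the least power of [br x] killing [y], the power [m] sends [exp_ad br x y] to the
    nonzero leading term [iter m (br x) y]. *)
Lemma exp_ad_inj0 y : exp_ad br x y = 0 -> y = 0.
Proof.
move=> ey; have ex : exists m, iter m (br x) y == 0 by exists n; rewrite xnil.
case: (ex_minnP ex) => [[|m]] /eqP ym ymin; first exact: ym.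
have : iter m (ad x) (exp_ad br x y) = iter m (br x) y.
  have iterZ a u : iter m (ad x) (a *: u) = a *: iter m (ad x) u by rewrite !iter_lfunE linearZ.
  rewrite /exp_ad big_ord_recl iter_lfunD /= fact0 invr1 scale1r (iter_ad La).
  have iter0 : iter m (ad x) 0 = 0 by rewrite iter_lfunE linear0.
  rewrite (big_morph _ (iter_lfunD (ad x) m) iter0) big1 ?addr0 // => i _.
  rewrite iterZ (iter_ad La) -iterS -iterD add0n addnS -addSn addnC iterD ym.
  by rewrite -(iter_ad La) iter_lfunE linear0 scaler0.
rewrite ey iter_lfunE linear0 => /esym/eqP/ymin; by rewrite ltnn.
Qed.
End Exponential.

(** * Rational families of matrices and generic rank *)

Section RationalFamilies.
Variables (k : closedFieldType) (ts : seq k).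
Hypothesis ch0 : [pchar k] =i pred0.

(* [g] agrees with a rational function regular at [ts], wherever the latter is defined. *)
Definition rational_at (g : k -> k) := exists D p : {poly k},
  (forall t, t \in ts -> D.[t] != 0) /\ forall t, D.[t] != 0 -> g t = p.[t] / D.[t].

Lemma rational_ext g h : g =1 h -> rational_at g -> rational_at h.
Proof. by move=> gh [D [p [D0 gp]]]; exists D, p; split=> // t /gp; rewrite gh. Qed.

Lemma rational_horner (p : {poly k}) : rational_at (horner p).
Proof.
by exists 1, p; split=> t; rewrite hornerC ?oner_eq0 // divr1.
Qed.

Lemma rational_const c : rational_at (fun=> c).
Proof. by apply: rational_ext (rational_horner c%:P) => t; rewrite hornerC. Qed.

Lemma rationalD g h : rational_at g -> rational_at h -> rational_at (fun t => g t + h t).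
Proof.
move=> [D [p [D0 gp]]] [E [r [E0 hr]]]; exists (D * E), (p * E + r * D); split=> t.
  by move=> tin; rewrite hornerM mulf_neq0 ?D0 ?E0.
rewrite !hornerE mulf_eq0 negb_or => /andP[Dt Et]; rewrite gp // hr //.
by field; rewrite Dt Et.
Qed.

Lemma rationalM g h : rational_at g -> rational_at h -> rational_at (fun t => g t * h t).
Proof.
move=> [D [p [D0 gp]]] [E [r [E0 hr]]]; exists (D * E), (p * r); split=> t.
  by move=> tin; rewrite hornerM mulf_neq0 ?D0 ?E0.
rewrite !hornerE mulf_eq0 negb_or => /andP[Dt Et]; rewrite gp // hr //.
by field; rewrite Dt Et.
Qed.

Lemma rationalV g : rational_at g -> (forall t, t \in ts -> g t != 0) ->
  rational_at (fun t => (g t)^-1).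
Proof.
move=> [D [p [D0 gp]]] g0; exists (D * p), (D * D); split=> t.
  move=> tin; rewrite hornerM mulf_neq0 ?D0 //.
  by have := g0 t tin; rewrite gp ?D0 // mulf_eq0 negb_or => /andP[].
rewrite !hornerE mulf_eq0 negb_or => /andP[Dt pt]; rewrite gp //.
by field; rewrite Dt pt.
Qed.

Lemma rational_sum I (r : seq I) (P : pred I) (F : I -> k -> k) :
  (forall i, P i -> rational_at (F i)) -> rational_at (fun t => \sum_(i <- r | P i) F i t).
Proof.
move=> rF; elim: r => [|i r IH].
  by apply: rational_ext (rational_const 0) => t; rewrite big_nil.
have [Pi|nPi] := boolP (P i).
  by apply: rational_ext (rationalD (rF i Pi) IH) => t; rewrite big_cons Pi.
by apply: rational_ext IH => t; rewrite big_cons (negPf nPi).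
Qed.

Lemma rational_prod I (r : seq I) (P : pred I) (F : I -> k -> k) :
  (forall i, P i -> rational_at (F i)) -> rational_at (fun t => \prod_(i <- r | P i) F i t).
Proof.
move=> rF; elim: r => [|i r IH].
  by apply: rational_ext (rational_const 1) => t; rewrite big_nil.
have [Pi|nPi] := boolP (P i).
  by apply: rational_ext (rationalM (rF i Pi) IH) => t; rewrite big_cons Pi.
by apply: rational_ext IH => t; rewrite big_cons (negPf nPi).
Qed.

Lemma rationalX g m : rational_at g -> rational_at (fun t => g t ^+ m).
Proof.
move=> rg; elim: m => [|m IH]; first exact: rational_const.
by apply: rational_ext (rationalM rg IH) => t; rewrite exprS.
Qed.

Lemma rational_exprz g (m : int) : rational_at g -> (forall t, t \in ts -> g t != 0) ->
  rational_at (fun t => g t ^ m).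
Proof.
move=> rg g0; case: m => m; first exact: (rationalX m rg).
by apply: rationalV (rationalX _ rg) _ => t tin; rewrite expf_neq0 ?g0.
Qed.

Lemma rational_generic g t0 : rational_at g -> t0 \in ts -> g t0 != 0 ->
  exists2 P : {poly k}, P != 0 & forall t, P.[t] != 0 -> g t != 0.
Proof.
move=> [D [p [D0 gp]]] tin; rewrite gp ?D0 // => pD.
exists (D * p) => [|t].
  by apply: contraNneq pD => /(congr1 (horner^~ t0)); rewrite hornerM horner0 => /eqP;
     rewrite mulf_eq0 (negPf (D0 _ tin)) /= => /eqP->; rewrite mul0r.
rewrite hornerM mulf_eq0 negb_or => /andP[Dt pt].
by rewrite gp // mulf_neq0 ?invr_neq0.
Qed.

Definition rational_mx m n (F : k -> 'M[k]_(m, n)) :=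
  forall i j, rational_at (fun t => F t i j).

Lemma rational_mx_ext m n (F G : k -> 'M[k]_(m, n)) : F =1 G -> rational_mx F -> rational_mx G.
Proof. by move=> FG rF i j; apply: rational_ext (rF i j) => t; rewrite FG. Qed.

Lemma rational_mx_const m n (A : 'M[k]_(m, n)) : rational_mx (fun=> A).
Proof. by move=> i j; exact: rational_const. Qed.

Lemma rational_mxD m n (F G : k -> 'M[k]_(m, n)) :
  rational_mx F -> rational_mx G -> rational_mx (fun t => F t + G t).
Proof. by move=> rF rG i j; apply: rational_ext (rationalD (rF i j) (rG i j)) => t; rewrite mxE. Qed.

Lemma rational_mulmx m n p (F : k -> 'M[k]_(m, n)) (G : k -> 'M[k]_(n, p)) :
  rational_mx F -> rational_mx G -> rational_mx (fun t => F t *m G t).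
Proof.
move=> rF rG i j; apply: rational_ext; first by move=> t; rewrite mxE.
by apply: rational_sum => l _; apply: rationalM.
Qed.

Lemma rational_scalemx m n g (F : k -> 'M[k]_(m, n)) :
  rational_at g -> rational_mx F -> rational_mx (fun t => g t *: F t).
Proof. by move=> rg rF i j; apply: rational_ext (rationalM rg (rF i j)) => t; rewrite mxE. Qed.

Lemma rational_summx m n I (r : seq I) (F : I -> k -> 'M[k]_(m, n)) :
  (forall i, rational_mx (F i)) -> rational_mx (fun t => \sum_(i <- r) F i t).
Proof.
move=> rF i j; apply: rational_ext; first by move=> t; rewrite summxE.
by apply: rational_sum => l _; apply: rF.
Qed.

Lemma rational_row_mx m n1 n2 (F : k -> 'M[k]_(m, n1)) (G : k -> 'M[k]_(m, n2)) :
  rational_mx F -> rational_mx G -> rational_mx (fun t => row_mx (F t) (G t)).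
Proof.
move=> rF rG i j; apply: rational_ext; first by move=> t; rewrite mxE.
by case: (split j) => l; [exact: rF | exact: rG].
Qed.

Lemma rational_expmx n (F : k -> 'M[k]_n) m : rational_mx F -> rational_mx (fun t => F t ^+ m).
Proof.
move=> rF; elim: m => [|m IH]; first exact: rational_mx_const.
by apply: rational_mx_ext (rational_mulmx rF IH) => t; rewrite exprS.
Qed.

Lemma rational_mxtrace n (F : k -> 'M[k]_n) : rational_mx F -> rational_at (fun t => \tr (F t)).
Proof. by move=> rF; apply: rational_sum => i _; apply: rF. Qed.

Lemma rational_det n (F : k -> 'M[k]_n) : rational_mx F -> rational_at (fun t => \det (F t)).
Proof.
move=> rF; apply: rational_sum => s _; apply: rationalM (rational_const _) _.
by apply: rational_prod => i _; apply: rF.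
Qed.

(** The cofactor formula is used for all [t], since [invmx] returns its argument unchanged where the
    matrix is singular. *)
Lemma rational_invmx n (F : k -> 'M[k]_n) : rational_mx F ->
  (forall t, F t \in unitmx \/ t \notin ts) -> exists2 G, rational_mx G &
    forall t, F t \in unitmx -> G t = invmx (F t).
Proof.
move=> rF uF; exists (fun t => (\det (F t))^-1 *: \adj (F t)) => [|t Ft]; last by rewrite /invmx Ft.
apply: rational_scalemx.
  apply: rationalV; first exact: rational_det.
  by move=> t tin; have [|/negP//] := uF t; rewrite unitmxE unitfE.
move=> i j; apply: rational_ext; first by move=> t; rewrite !mxE.
apply: rationalM (rational_const _) _; apply: rational_det => a b.
by apply: rational_ext (rF (lift j a) (lift i b)) => t; rewrite !mxE.
Qed.

(** The fixed factors [L] and [R] cut out of [F t0] an identity block of size its rank; the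
    determinant of the same block of [F t] is rational and nonzero at [t0], hence nonzero
    generically. *)
Lemma rational_rank_generic m n (F : k -> 'M[k]_(m, n)) t0 : rational_mx F -> t0 \in ts ->
  exists2 P : {poly k}, P != 0 & forall t, P.[t] != 0 -> (\rank (F t0) <= \rank (F t))%N.
Proof.
move=> rF tin; set r := \rank (F t0).
pose L : 'M[k]_(r, m) := pid_mx r *m invmx (col_ebase (F t0)).
pose R : 'M[k]_(n, r) := invmx (row_ebase (F t0)) *m pid_mx r.
have LFR : L *m F t0 *m R = 1%:M.
  rewrite /L /R -{2}(mulmx_ebase (F t0)) !mulmxA.
  rewrite mulmxKV ?col_ebase_unit // mulmxK ?row_ebase_unit //.
  by rewrite !pid_mx_id ?rank_leq_row ?rank_leq_col // pid_mx_1.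
have [||P P0 PP] := @rational_generic (fun t => \det (L *m F t *m R)) t0 _ tin.
- apply/rational_det/rational_mulmx/rational_mx_const.
  exact/rational_mulmx/rF/rational_mx_const.
- by rewrite LFR det1 oner_eq0.
exists P => // t /PP; rewrite -unitfE -unitmxE => /mxrank_unit <-.
by apply: leq_trans (mxrankM_maxl _ _) (mxrankM_maxr _ _).
Qed.
End RationalFamilies.

(** * Paths and tori *)

Section InnerPaths.
Variables (k : closedFieldType) (V : vectType k) (br : V -> V -> V).
Hypothesis La : lie_algebra br.
Hypothesis ch0 : [pchar k] =i pred0.
Local Notation n := (\dim {:V}).
Local Notation ad := (ad br).

Lemma f2mx_sum I (r : seq I) (F : I -> 'End(V)) :
  f2mx (\sum_(i <- r) F i) = \sum_(i <- r) f2mx (F i).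
Proof.
elim/big_rec2: _ => [|i A f _ <-]; last by rewrite f2mxD.
by apply: mx_v2r_inj => v; rewrite -v2r_lfun zero_lfunE linear0 mulmx0.
Qed.

(** The exponential of [t *: ad x] written by powers of [t], which displays its polynomial
    dependence on [t]. *)
Definition exp_path x t : 'End(V) :=
  \sum_(i < n.+1) ((i`!%:R)^-1 * t ^+ i) *: Hom (f2mx (ad x) ^+ i).

Lemma exp_pathE x t v : exp_path x t v = exp_ad br (t *: x) v.
Proof.
rewrite /exp_path /exp_ad sum_lfunE; apply: eq_bigr => i _.
rewrite scale_lfunE -iter_lfunE -scalerA; congr (_ *: _).
elim: (nat_of_ord i) => [|m IH]; first by rewrite scale1r.
by rewrite [in RHS]iterS -IH (brZl La) (brZr La) /= (adE La) scalerA exprS.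
Qed.

(** All nilpotent elements are multiplied by the same parameter. The last clause allows a rational
    reparametrization [g], as needed to place the ends of the path. *)
Lemma inner_path (xs : seq V) : (forall x, x \in xs -> ad_nilpotent br x) ->
  exists Phi : k -> 'End(V),
    [/\ forall t, lie_morphism br (Phi t) /\ lker (Phi t) == 0%VS, Phi 0 = \1%VF,
        forall v, Phi 1 v = foldr (fun x f => exp_ad br x \o f) id xs v &
        forall ts g, rational_at ts g -> rational_mx ts (fun t => f2mx (Phi (g t)))].
Proof.
elim: xs => [|x xs IH] xsn.
  exists (fun=> \1%VF); split=> // [t|v|ts g _]; last exact: rational_mx_const.
    split; first by move=> y z; rewrite !id_lfunE.
    by apply/lker0P => y z; rewrite !id_lfunE.
  by rewrite id_lfunE.
have [y yin|Phi [Phim Phi0 Phi1 Phir]] := IH; first by apply: xsn; rewrite inE yin orbT.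
have xn t : ad_nilpotent br (t *: x).
  have xn := xsn x (mem_head _ _) => y.
  suff -> : iter n (br (t *: x)) y = t ^+ n *: iter n (br x) y by rewrite xn scaler0.
  elim: {xn} (\dim {:V}) => [|m IHm]; first by rewrite scale1r.
  by rewrite iterS IHm (brZl La) (brZr La) scalerA -exprS.
exists (fun t => exp_path x t \o Phi t)%VF; split.
- move=> t; have [Pm P0] := Phim t; split.
    by move=> y z; rewrite !comp_lfunE Pm !exp_pathE exp_ad_morphism.
  apply/lker0P => y z; rewrite !comp_lfunE => /eqP; rewrite -subr_eq0 -linearB /= exp_pathE.
  move=> /eqP /(exp_ad_inj0 La (xn t)) /eqP; rewrite subr_eq0 => /eqP.
  by move/lker0P: P0; apply.
- rewrite Phi0 comp_lfun1r; apply/lfunP => v; rewrite exp_pathE scale0r id_lfunE.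
  rewrite /exp_ad big_ord_recl fact0 invr1 scale1r big1 ?addr0 // => i _.
  by rewrite /= (br0l La) scaler0.
- by move=> v; rewrite comp_lfunE exp_pathE scale1r Phi1.
- move=> ts g rg; apply: rational_mx_ext; first by move=> t; rewrite f2mx_comp.
  apply: rational_mulmx; first exact: Phir.
  apply: rational_mx_ext; first by move=> t; rewrite /exp_path f2mx_sum.
  apply: rational_summx => i; apply: rational_mx_ext; first by move=> t; rewrite f2mxZ.
  apply: rational_scalemx; last exact: rational_mx_const.
  exact: rationalM (rational_const _ _) (rationalX _ rg).
Qed.

Lemma morphism_on_basis (f : 'End(V)) (b : n.-tuple V) : basis_of fullv b ->
  (forall i j : 'I_n, f (br b`_i b`_j) = br (f b`_i) (f b`_j)) -> lie_morphism br f.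
Proof.
move=> bb fb.
have fbx (i : 'I_n) y : f (br b`_i y) = br (f b`_i) (f y).
  have : (f \o ad b`_i)%VF = (ad (f b`_i) \o f)%VF.
    by apply: (lfun_eq_basis bb) => j; rewrite !comp_lfunE !(adE La) fb.
  by move/lfunP/(_ y); rewrite !comp_lfunE !(adE La).
move=> x y; have : (f \o ad y)%VF = (ad (f y) \o f)%VF.
  apply: (lfun_eq_basis bb) => i; rewrite !comp_lfunE !(adE La).
  by rewrite (br_anti La y) (linearN f) /= fbx -(br_anti La).
move/lfunP/(_ x); rewrite !comp_lfunE !(adE La) (br_anti La y) (linearN f) /=.
by rewrite (br_anti La (f y)) => /oppr_inj.
Qed.

Lemma char0_intr_inj : injective (fun m : int => m%:~R : k).
Proof.
move=> a b /eqP; rewrite -subr_eq0 -rmorphB => ab; apply/eqP; rewrite -subr_eq0.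
by apply: contraT => /(char0_mulrz_eq0 (x := 1 : k^o) ch0)/(_ (eqP ab))/eqP; rewrite oner_eq0.
Qed.

(** An integer above 1 has infinite multiplicative order in characteristic 0, so a torus evaluated
    there still separates its integral weights. *)
Lemma char0_exprz_inj m : (1 < m)%N -> injective (fun a : int => (m%:R : k) ^ a).
Proof.
move=> m1; have m0 : (m%:R : k) != 0 by rewrite ((pcharf0P _).1 ch0) -lt0n ltnW.
have nat_inj (p : nat) : (m%:R : k) ^+ p = 1 -> p = 0%N.
  rewrite -natrX -[1]/(1%:R) => /(char0_natf_inj ch0) /eqP.
  by rewrite -(expn0 m) eqn_exp2l // => /eqP.
move=> a b /= ab; have : (m%:R : k) ^ (a - b) = 1.
  by rewrite expfzDr // -exprz_inv -expfV ab divff // expfz_neq0.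
move=> h; apply/eqP; rewrite -subr_eq0; case: (a - b) h => p.
  by move=> /nat_inj->.
move=> h; have /nat_inj// : (m%:R : k) ^+ p.+1 = 1.
by rewrite -[LHS]invrK (h : (m%:R ^+ p.+1)^-1 = 1) invr1.
Qed.

(* [T tau] is tau ^ (ad x). *)
Lemma integral_torus x (b : n.-tuple V) (q : 'I_n -> int) : basis_of fullv b ->
  (forall i : 'I_n, br x b`_i = (q i)%:~R *: b`_i) ->
  exists T : k -> 'End(V),
    [/\ forall tau (i : 'I_n), T tau b`_i = tau ^ q i *: b`_i,
        forall tau, tau != 0 -> lie_morphism br (T tau) /\ lker (T tau) == 0%VS,
        forall s tau, lie_morphism br s -> (forall y, s (s y) = y) -> s x = - x -> tau != 0 ->
          (s \o T tau = T (tau^-1)%R \o s)%VF &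
        forall ts g, rational_at ts g -> (forall t, t \in ts -> g t != 0) ->
          rational_mx ts (fun t => f2mx (T (g t)))].
Proof.
move=> bb bx.
have /fin_all_exists[E EP] (p : 'I_n) := @diagonal_on_basis _ _ b (fun i => (i == p)%:R) bb.
have Eb (p i : 'I_n) : E p b`_i = (i == p)%:R *: b`_i.
  apply: EP => j; rewrite coord_free ?(basis_free bb) //.
  by have [->|] := eqVneq i j; rewrite ?eqxx.
pose T tau : 'End(V) := \sum_p (tau ^ q p) *: E p.
have Tb tau (i : 'I_n) : T tau b`_i = tau ^ q i *: b`_i.
  rewrite sum_lfunE (bigD1 i) //= scale_lfunE Eb eqxx scale1r big1 ?addr0 // => p pi.
  by rewrite scale_lfunE Eb eq_sym (negPf pi) scale0r scaler0.
have Tw tau m v : br x v = m%:~R *: v -> T tau v = tau ^ m *: v.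
  move=> xv; rewrite (coord_basis bb (memvf v)) linear_sum scaler_sumr.
  apply: eq_bigr => i _; rewrite linearZ /= Tb.
  have [->|ci] := eqVneq (coord b i v) 0; first by rewrite !scale0r scaler0.
  rewrite !scalerA mulrC; congr (_ ^ _ * _ *: _); apply: char0_intr_inj.
  apply: (@coord_eigen _ _ b (ad x) (fun i => (q i)%:~R) _ v i bb) => // [j|].
    by rewrite (adE La).
  by rewrite (adE La).
exists T; split=> //.
- move=> tau t0; split.
    apply: (morphism_on_basis bb) => i j; rewrite !Tb (brZl La) (brZr La) scalerA -expfzDr //.
    apply: Tw; rewrite -(adE La) (ad_derivation La) !(adE La) !bx (brZl La) (brZr La).
    by rewrite -scalerDl rmorphD.
  have inv : (T (tau^-1)%R \o T tau)%VF = \1%VF.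
    apply: (lfun_eq_basis bb) => i; rewrite comp_lfunE Tb linearZ /= Tb id_lfunE scalerA.
    by rewrite exprz_inv -expfzDr // subrr scale1r.
  apply/lker0P => y z /(congr1 (T tau^-1)).
  by rewrite -!comp_lfunE inv !id_lfunE.
- move=> s tau sm ss sx t0; apply: (lfun_eq_basis bb) => i; rewrite !comp_lfunE Tb linearZ /=.
  rewrite (Tw _ (- q i)); first by rewrite exprz_inv opprK.
  by rewrite -[x]ss -sm sx (brNl La) bx linearN linearZ rmorphN scaleNr.
- move=> ts g rg g0; apply: rational_mx_ext; first by move=> t; rewrite f2mx_sum.
  apply: rational_summx => i; apply: rational_mx_ext; first by move=> t; rewrite f2mxZ.
  by apply: rational_scalemx (rational_exprz _ rg g0) (rational_mx_const _ _).
Qed.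
End InnerPaths.

(** * Fixed vectors *)

Section Degeneration.
Variables (k : closedFieldType) (V : vectType k) (br : V -> V -> V).
Hypothesis La : lie_algebra br.
Hypothesis ch0 : [pchar k] =i pred0.
Local Notation n := (\dim {:V}).
Local Notation ad := (ad br).
Local Notation killing := (killing br).
Hypothesis nd : forall x, (forall y, killing x y = 0) -> x = 0.

Lemma f2mx_inv (f : 'End(V)) : lker f == 0%VS ->
  f2mx f \in unitmx /\ f2mx f^-1%VF = invmx (f2mx f).
Proof.
move=> f0; have e : f2mx f^-1%VF *m f2mx f = 1%:M by rewrite -f2mx_comp lker0_compfV // f2mx1.
have [_ fu] := mulmx1_unit e; split=> //.
by rewrite -[LHS]mulmx1 -(mulmxV fu) mulmxA e mul1mx.
Qed.

(** Row [j] is, up to the factor [j], the differential of [tr (theta ^ j)] in the directions of [a].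
    Exponents up to [n] leave room for interpolation at [n] eigenvalues. *)
Definition trace_mx (theta : 'End(V)) (a : {vspace V}) : 'M[k]_(n.+1, \dim a) :=
  \matrix_(j, l) ltr (Hom (f2mx theta ^+ j) \o ad (vbasis a)`_l)%VF.

Lemma Hom_exp_comm (f : 'End(V)) j : (f \o Hom (f2mx f ^+ j) = Hom (f2mx f ^+ j) \o f)%VF.
Proof. by apply: val_inj; rewrite /= !f2mx_comp /= -[_ *m f2mx f]exprSr exprS. Qed.

(* The gradient [v] of [theta |-> tr (theta ^ j)] is fixed by [theta], hence
   [v - s v] is a fixed vector in the (-1)-eigenspace of [s]. *)
Lemma rank_trace_mx (theta s : 'End(V)) (a : {vspace V}) :
  lie_morphism br theta -> lker theta == 0%VS ->
  lie_morphism br s -> (forall v, s (s v) = v) ->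
  (forall v, theta (s (theta (s v))) = v) -> (forall z, z \in a -> s z = - z) ->
  (\rank (trace_mx theta a) <= \dim (lker (theta - \1%VF)%R :&: lker (s + \1%VF)%R))%N.
Proof.
move=> tm t0 sm ss tsts sa; set W := (_ :&: _)%VS.
have two0 : (2%:R : k) != 0 by rewrite ((pcharf0P _).1 ch0).
have gradient (j : 'I_n.+1) : exists u, u \in W /\
    forall z, z \in a -> killing u z = ltr (Hom (f2mx theta ^+ j) \o ad z)%VF.
  set P : 'End(V) := Hom _.
  have [|v vP] := @killing_riesz _ _ _ La nd (fun z => ltr (P \o ad z)%VF).
    by move=> b y z; rewrite (adP La) comp_lfunDr -comp_lfunZr ltrD ltrZ.
  have tv : theta v = v.
    apply/eqP; rewrite -subr_eq0; apply/eqP/nd => z.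
    rewrite -(lker0_lfunVK t0 z); set y := (_^-1)%VF z.
    rewrite (killingDl La) (killingNl La) (killing_morphism La) // !vP.
    have -> : ad (theta y) = (theta \o ad y \o theta^-1)%VF.
      by rewrite (ad_morphism La) // lker0_compfK.
    have tP : ltr (P \o ((theta \o ad y) \o theta^-1))%VF = ltr (P \o ad y)%VF.
      have Pt : (P \o theta = theta \o P)%VF by rewrite -Hom_exp_comm.
      transitivity (ltr (theta^-1 \o (theta \o (P \o ad y)))%VF); last by rewrite lker0_compKf.
      by rewrite [RHS]ltrC !comp_lfunA Pt.
    by rewrite tP subrr.
  have tsv : theta (s v) = s v by rewrite -{1}tv -[in LHS](ss v).
  (* The half makes this the projection of [v] to the (-1)-eigenspace of [s]; on [a], it has the
     same pairing as [v]. *)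
  exists (2%:R^-1 *: (v - s v)); split.
    apply: memvZ; rewrite memv_cap !memv_ker !add_lfunE opp_lfunE !id_lfunE.
    have -> : theta (v - s v) = v - s v by rewrite linearB /= tv tsv.
    have -> : s (v - s v) = - (v - s v) by rewrite (linearB s) /= ss [RHS]opprB.
    by rewrite subrr addNr eqxx.
  move=> z za; rewrite (killingZl La) (killingDl La) (killingNl La).
  have zE : z = - s z by rewrite sa // opprK.
  rewrite {2}zE (killingNr La) (killing_morphism La) ?involution_lker0 //.
  by rewrite opprK -mulr2n -(mulr_natl (killing v z)) mulKf // vP.
have [u uP] := fin_all_exists gradient.
(* The matrix factors through coordinates in [W], which bounds its rank by [dim W]. *)
have -> : trace_mx theta a = (\matrix_(j, m) coord (vbasis W) m (u j)) *m
    (\matrix_(m, l) killing (vbasis W)`_m (vbasis a)`_l).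
  apply/matrixP => j l; rewrite !mxE; have [uW uE] := uP j.
  rewrite -uE; last by apply/vbasis_mem/mem_nth; rewrite size_tuple.
  rewrite {1}(coord_vbasis uW); elim/big_rec2: _ => [|m y1 y2 _ <-]; first exact: killing0l.
  by rewrite (killingPl La) !mxE.
exact: leq_trans (mxrankM_maxl _ _) (rank_leq_col _).
Qed.
Lemma iter_eigen (f : 'End(V)) (r : k) v j : f v = r *: v -> iter j f v = r ^+ j *: v.
Proof.
move=> fv; elim: j => [|j IH]; first by rewrite scale1r.
by rewrite iterS IH linearZ /= fv scalerA exprSr.
Qed.

(* For [z] in [a], [tr (T ^ j \o ad z)] is the sum of the [(4 ^ q i) ^ j * wt i z];
   Lagrange interpolation at the points [4 ^ q i] isolates each [wt i z]. *)
Lemma rank_trace_mx_torus (a : {vspace V}) (b : n.-tuple V) (q : 'I_n -> int)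
    (wt : 'I_n -> V -> k) (T : 'End(V)) :
  basis_of fullv b -> (forall i : 'I_n, T b`_i = 4%:R ^ q i *: b`_i) ->
  (forall z, z \in a -> forall i : 'I_n, br z b`_i = wt i z *: b`_i) ->
  (forall z i j, z \in a -> q i = q j -> wt i z = wt j z) ->
  (\dim a <= \rank (trace_mx T a))%N.
Proof.
move=> bb Tb wtP wtq; rewrite -mxrank_tr.
suff /eqP-> : row_free (trace_mx T a)^T by [].
rewrite -kermx_eq0; apply/eqP/row_matrixP => r; rewrite row0.
set y := row r _; have yA : y *m (trace_mx T a)^T = 0 by rewrite -row_mul mulmx_ker row0.
pose z := \sum_l y 0 l *: (vbasis a)`_l.
have za : z \in a.
  apply: memv_suml => l _; apply/memvZ/vbasis_mem/mem_nth; by rewrite size_tuple.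
have trz (j : 'I_n.+1) : \sum_i (4%:R ^ q i) ^+ j * wt i z = 0.
  have : ltr (Hom (f2mx T ^+ j) \o ad z)%VF = 0.
    have /rowP/(_ j) := yA; rewrite !mxE => <-.
    rewrite /z; elim/big_rec2: _ => [|l e u _ <-].
      by rewrite -(scale0r 0) (adZ La) scale0r comp_lfun0r -(scale0r 0) ltrZ mul0r.
    by rewrite (adP La) comp_lfunDr -comp_lfunZr ltrD ltrZ !mxE.
  rewrite (basis_ltr_diag (q := fun i => (4%:R ^ q i) ^+ j * wt i z) bb) // => i.
  rewrite comp_lfunE (adE La) wtP // linearZ /= -iter_lfunE (iter_eigen _ (Tb i)).
  by rewrite scalerA mulrC.
have wt0 i0 : wt i0 z = 0.
  pose l0 := [seq i <- enum 'I_n | 4%:R ^ q i != 4%:R ^ q i0 :> k].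
  pose p := \prod_(i <- l0)
    ('X - (4%:R ^ q i)%:P : {poly k}).
  have sp : (size p <= n.+1)%N.
    rewrite size_prod_XsubC ltnS size_filter (leq_trans (count_size _ _)) //.
    by rewrite size_enum_ord.
  have : \sum_i p.[4%:R ^ q i] * wt i z = 0.
    under eq_bigr => i _ do rewrite (horner_coef_wide _ sp) mulr_suml.
    rewrite exchange_big big1 //= => j _.
    under eq_bigr => i _ do rewrite -mulrA.
    by rewrite -mulr_sumr trz mulr0.
  have pz i : 4%:R ^ q i != 4%:R ^ q i0 :> k -> p.[4%:R ^ q i] = 0.
    move=> qi; have il : i \in l0 by rewrite mem_filter qi mem_enum.
    by rewrite /p (big_rem i il) /= hornerM hornerXsubC subrr mul0r.
  have p0 : p.[4%:R ^ q i0] != 0.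
    rewrite /p horner_prod prodf_seq_neq0; apply/allP => l; rewrite mem_filter => /andP[qi _].
    by rewrite hornerXsubC subr_eq0 eq_sym.
  (* The surviving indices share the weight of [i0]; their number is positive, hence nonzero in
     [k]. *)
  rewrite (bigID (fun i => q i == q i0)) /= [X in _ + X]big1 ?addr0; last first.
    move=> i qi; rewrite pz ?mul0r //; apply: contra qi => /eqP /(char0_exprz_inj (m := 4) ch0 isT) ->.
    exact: eqxx.
  rewrite (eq_bigr (fun=> p.[4%:R ^ q i0] * wt i0 z)); last first.
    by move=> i /eqP qi; rewrite qi (wtq z i i0 za qi).
  rewrite sumr_const -(mulr_natl (p.[_] * _)) => /eqP; rewrite !mulf_eq0 (negPf p0) /=.
  rewrite ((pcharf0P _).1 ch0) => /orP[|/eqP//].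
  by move=> /eqP/card0_eq/(_ i0) h; have : (q i0 == q i0) = false := h; rewrite eqxx.
have z0 : z = 0.
  apply: (ad_inj La nd); apply: (lfun_eq_basis bb) => i.
  by rewrite !(adE La) (br0l La) wtP // wt0 scale0r.
apply/rowP => l; rewrite [RHS]mxE.
have := coord_sum_free (y 0) l (basis_free (vbasisP a)).
by rewrite -/z z0 linear0.
Qed.

(** Both involutions invert the torus, so [s2 s1] commutes with [T 4], and applying the fixed-point
    equation twice gives [T 4 (T 4 w) = w]. The eigenvalues of this square are [16 ^ q i], so [w]
    involves only [q i = 0]: it centralizes [c] and is fixed by [T 4]. The equation then reads
    [s2 (s1 w) = w], whence [s1 w = - w]. *)
Lemma torus_endpoint_fixed s1 s2 (c : {vspace V}) x (b : n.-tuple V) (q : 'I_n -> int)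
    (wt : 'I_n -> V -> k) (T : k -> 'End(V)) :
  lie_morphism br s1 -> lie_morphism br s2 ->
  (forall x, s1 (s1 x) = x) -> (forall x, s2 (s2 x) = x) ->
  (forall x, s1 (s2 x) = s2 (s1 x)) ->
  cartan_subspace br (anti s1 s2) c -> basis_of fullv b ->
  (forall tau (i : 'I_n), T tau b`_i = tau ^ q i *: b`_i) ->
  (forall z, z \in c -> forall i : 'I_n, br z b`_i = wt i z *: b`_i) ->
  (forall z i, z \in c -> q i = 0 -> wt i z = 0) ->
  s1 x = - x -> s2 x = - x ->
  (forall s tau, lie_morphism br s -> (forall y, s (s y) = y) -> s x = - x -> tau != 0 ->
    (s \o T tau = T tau^-1%R \o s)%VF) ->
  forall w, s2 (s1 (T 4%:R w)) = w -> s2 w = - w -> w \in c.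
Proof.
move=> m1 m2 i1 i2 s12 cP bb Tb wtP wt0 x1 x2 sT w fw w2.
have t0 : (4%:R : k) != 0 by rewrite ((pcharf0P _).1 ch0).
have Ts v : T 4%:R (s2 (s1 v)) = s2 (s1 (T 4%:R v)).
  have := sT s1 _ m1 i1 x1 t0 => /lfunP/(_ v); rewrite !comp_lfunE => ->.
  have := sT s2 _ m2 i2 x2 (invr_neq0 t0) => /lfunP/(_ (s1 v)); rewrite !comp_lfunE => ->.
  by rewrite invrK.
have TT : T 4%:R (T 4%:R w) = w.
  have := fw; rewrite -{1}fw Ts -s12 i2 i1; exact.
have cq i : coord b i w != 0 -> q i = 0.
  move=> ci; apply: (char0_exprz_inj (m := 16) ch0 isT).
  apply: (@coord_eigen _ _ b (T 4%:R \o T 4%:R)%VF (fun i => 16%:R ^ q i) _ w i bb) ci => [j|].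
    rewrite comp_lfunE Tb linearZ /= Tb scalerA -expfzMl -natrM //.
  by rewrite comp_lfunE TT scale1r.
have wE (f : 'End(V)) (r : 'I_n -> k) r0 : (forall i : 'I_n, f b`_i = r i *: b`_i) ->
    (forall i, q i = 0 -> r i = r0) -> f w = r0 *: w.
  move=> fb r0P; rewrite {1}(coord_basis bb (memvf w)) linear_sum.
  rewrite [in RHS](coord_basis bb (memvf w)) scaler_sumr; apply: eq_bigr => i _.
  rewrite linearZ /= fb !scalerA mulrC.
  by have [->|/cq/r0P->//] := eqVneq (coord b i w) 0; rewrite !mulr0 !scale0r.
have Tw : T 4%:R w = w.
  by rewrite (wE _ _ 1 (Tb 4%:R)) ?scale1r // => i ->.
apply: (cartan_centralizer La ch0 nd m1 m2 i1 i2 s12 cP).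
  by split=> //; rewrite -{1}[w]i2 w2 -{1}fw Tw s12 !linearN /= s12 i1 i2.
by move=> z zc; rewrite -(adE La) (wE _ (wt^~ z) 0) ?scale0r // => i; rewrite ?(adE La) ?wtP //; exact: wt0.
Qed.
End Degeneration.

(** * The rational family and the dimension bound *)

Section Path.
Variables (k : closedFieldType) (V : vectType k) (br : V -> V -> V).
Hypothesis La : lie_algebra br.
Hypothesis ch0 : [pchar k] =i pred0.
Local Notation n := (\dim {:V}).
Local Notation ad := (ad br).
Local Notation killing := (killing br).
Hypothesis nd : forall x, (forall y, killing x y = 0) -> x = 0.

Lemma lker0_comp (f g : 'End(V)) : lker f == 0%VS -> lker g == 0%VS -> lker (f \o g)%VF == 0%VS.
Proof.
move=> /lker0P f0 /lker0P g0; apply/lker0P => x y; rewrite !comp_lfunE.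
by move=> /f0 /g0.
Qed.

Lemma lie_morphism_comp (f g : 'End(V)) : lie_morphism br f -> lie_morphism br g ->
  lie_morphism br (f \o g)%VF.
Proof. by move=> fm gm x y; rewrite !comp_lfunE gm fm. Qed.

Lemma lie_morphism_inv (f : 'End(V)) : lie_morphism br f -> lker f == 0%VS ->
  lie_morphism br f^-1%VF.
Proof.
move=> fm f0 x y; move/lker0P: (f0) => fi; apply: fi.
by rewrite fm !lker0_lfunVK.
Qed.

Lemma memv_r2v (r : 'rV[k]_(dim V)) (U : {vspace V}) :
  (r2v r \in U) = (r <= vs2mx U)%MS.
Proof. by rewrite memvE /subsetv mx2vsK r2vK. Qed.

Lemma mulmx_f2mx_sub1 (f : 'End(V)) v :
  (v2r v *m (f2mx f - 1%:M) == 0) = (v \in lker (f - \1%VF)).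
Proof.
rewrite memv_ker add_lfunE opp_lfunE id_lfunE mulmxBr mulmx1 -v2r_lfun -linearB.
by rewrite (can2_eq v2rK r2vK) linear0.
Qed.

Lemma mulmx_f2mx_add1 (f : 'End(V)) v :
  (v2r v *m (f2mx f + 1%:M) == 0) = (v \in lker (f + \1%VF)).
Proof.
rewrite memv_ker add_lfunE id_lfunE mulmxDr mulmx1 -v2r_lfun -linearD.
by rewrite (can2_eq v2rK r2vK) linear0.
Qed.

Lemma cartan_dim_le (s1 s2 : 'End(V)) (Phi : k -> 'End(V)) (a c : {vspace V}) :
  lie_morphism br s1 -> lie_morphism br s2 ->
  (forall x, s1 (s1 x) = x) -> (forall x, s2 (s2 x) = x) ->
  (forall x, s1 (s2 x) = s2 (s1 x)) ->
  (forall t, lie_morphism br (Phi t) /\ lker (Phi t) == 0%VS) -> Phi 0 = \1%VF ->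
  (forall ts g, rational_at ts g -> rational_mx ts (fun t => f2mx (Phi (g t)))) ->
  (forall v, s2 (Phi 1 v) = Phi 1 (s1 v)) ->
  cartan_subspace br (anti s2 s2) a -> cartan_subspace br (anti s1 s2) c ->
  (\dim a <= \dim c)%N.
Proof.
move=> m1 m2 i1 i2 s12 Phim Phi0 Phir s2Phi aP cP.
have [h [b [q [wt [ha bb hb wtP wtq]]]]] := integral_regular_element La ch0 nd m2 m2 i2 i2 (fun=> erefl) aP.
have [x [b' [q' [wt' [xc bb' xb' wtP' wtq']]]]] := integral_regular_element La ch0 nd m1 m2 i1 i2 s12 cP.
have [T [Tb Tm Ts Tr]] := integral_torus La ch0 bb hb.
have [T' [Tb' Tm' Ts' Tr']] := integral_torus La ch0 bb' xb'.
have [[aA _ _] [cA _ _]] := (aP, cP).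
have h2 : s2 h = - h by case: (aA h ha).
have [x1 x2] := cA x xc.
have nz m : (m.+1%:R : k) != 0 by rewrite ((pcharf0P _).1 ch0).
have three : 3%:R - 1 = 2%:R :> k := esym (natrB k (isT : 1 <= 3)%N).
have three' : 3%:R - 2%:R = 1 :> k := esym (natrB k (isT : 2 <= 3)%N).
have two : 2%:R - 1 = 1 :> k := esym (natrB k (isT : 1 <= 2)%N).
have four : 2%:R * 2%:R = 4%:R :> k := esym (natrM k 2 2).
pose ts : seq k := [:: 1; 2%:R].
have tsP t : t \in ts -> t != 0 /\ 3%:R - t != 0.
  rewrite !inE => /orP[]/eqP->; split; rewrite ?oner_eq0 //.
  - by rewrite three.
  - by rewrite three' oner_eq0.
have in2 : 2%:R \in ts by rewrite !inE eqxx orbT.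
(* The arguments are affine in [t] with [Psi 1 = T 2] and [Psi 2 = Phi 1 \o T' 2]. The involutions
   invert the tori, so [theta] doubles the exponents and 4 appears at both ends. *)
pose Psi t := (T (3%:R - t)%R \o Phi (t - 1)%R \o T' t)%VF.
have good t : t != 0 -> 3%:R - t != 0 -> lie_morphism br (Psi t) /\ lker (Psi t) == 0%VS.
  move=> t0 t3; have [A1 A2] := Tm _ t3; have [B1 B2] := Phim (t - 1); have [C1 C2] := Tm' _ t0.
  split; first by do 2?[apply: lie_morphism_comp => //].
  by do 2?[apply: lker0_comp => //].
have rsub (c0 e : k) : rational_at ts (fun t => c0 + e * t).
  apply: rational_ext (rational_horner ts (c0%:P + e *: 'X)) => t.
  by rewrite !hornerE.
have rPsi : rational_mx ts (fun t => f2mx (Psi t)).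
  apply: rational_mx_ext; first by move=> t; rewrite /Psi !f2mx_comp.
  apply: rational_mulmx.
    apply: (Tr' ts id); last by move=> t /tsP[].
    by apply: rational_ext (rsub 0 1) => t; rewrite add0r mul1r.
  apply: rational_mulmx.
    by apply: Phir; apply: rational_ext (rsub (-1) 1) => t; rewrite mul1r addrC.
  apply: Tr; last by move=> t /tsP[].
  by apply: rational_ext (rsub 3%:R (-1)) => t; rewrite mulN1r.
have uPsi t : f2mx (Psi t) \in unitmx \/ t \notin ts.
  have [tin|] := boolP (t \in ts); last by right.
  by left; have [t0 t3] := tsP t tin; have [_ /f2mx_inv[]] := good t t0 t3.
have [G rG GP] := rational_invmx rPsi uPsi.
(* Defined through the cofactor inverse [G] so as to be rational; matrices act on rows, whence the
   reversed order. [thetaE] identifies it wherever both tori are invertible. *)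
pose theta t : 'End(V) := Hom (f2mx (Psi t) *m f2mx s2 *m G t *m f2mx s2).
have thetaE t : t != 0 -> 3%:R - t != 0 ->
    theta t = (s2 \o (Psi t)^-1 \o s2 \o Psi t)%VF.
  move=> t0 t3; have [_ /f2mx_inv[pu pV]] := good t t0 t3.
  by apply: val_inj; rewrite /= !f2mx_comp pV -GP // !mulmxA.
have rtheta : rational_mx ts (fun t => f2mx (theta t)).
  apply: rational_mulmx; last exact: rational_mx_const.
  apply: rational_mulmx rG; apply: rational_mulmx rPsi _; exact: rational_mx_const.
have T1 : T 1 = \1%VF.
  by apply: (lfun_eq_basis bb) => i; rewrite Tb exp1rz scale1r id_lfunE.
have T1' : T' 1 = \1%VF.
  by apply: (lfun_eq_basis bb') => i; rewrite Tb' exp1rz scale1r id_lfunE.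
have TT : (T 2%:R \o T 2%:R)%VF = T 4%:R.
  by apply: (lfun_eq_basis bb) => i; rewrite comp_lfunE Tb linearZ /= Tb scalerA -expfzMl four Tb.
have TT' : (T' 2%:R \o T' 2%:R)%VF = T' 4%:R.
  by apply: (lfun_eq_basis bb') => i; rewrite comp_lfunE Tb' linearZ /= Tb' scalerA -expfzMl four Tb'.
have Tinv v : T 2%:R^-1 (T 2%:R v) = v.
  suff /lfunP/(_ v) : (T (2%:R^-1)%R \o T 2%:R)%VF = \1%VF by rewrite comp_lfunE id_lfunE.
  apply: (lfun_eq_basis bb) => i; rewrite comp_lfunE Tb linearZ /= Tb scalerA -expfzMl.
  by rewrite divff ?nz // exp1rz scale1r id_lfunE.
have Tinv' v : T' 2%:R^-1 (T' 2%:R v) = v.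
  suff /lfunP/(_ v) : (T' (2%:R^-1)%R \o T' 2%:R)%VF = \1%VF by rewrite comp_lfunE id_lfunE.
  apply: (lfun_eq_basis bb') => i; rewrite comp_lfunE Tb' linearZ /= Tb' scalerA -expfzMl.
  by rewrite divff ?nz // exp1rz scale1r id_lfunE.
have [[_ t13] [t20 t23]] := (tsP 1 (mem_head _ _), tsP 2%:R in2).
have ss2 : (s2 \o s2)%VF = \1%VF by apply/lfunP => v; rewrite comp_lfunE i2 id_lfunE.
have theta1 : theta 1 = T 4%:R.
  rewrite thetaE ?oner_eq0 // /Psi three subrr Phi0 T1' !comp_lfun1r.
  have [_ K] := Tm _ (nz 1); apply/lfunP => v; rewrite !comp_lfunE -TT comp_lfunE.
  suff -> : (T 2%:R)^-1%VF (s2 (T 2%:R v)) = s2 (T 2%:R (T 2%:R v)) by rewrite i2.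
  rewrite -[RHS](lker0_lfunK K); congr (_ _).
  have /lfunP/(_ (T 2%:R (T 2%:R v))) := Ts s2 _ m2 i2 h2 (invr_neq0 (nz 1)).
  by rewrite !comp_lfunE invrK Tinv => ->.
have theta2 : theta 2%:R = (s2 \o s1 \o T' 4%:R)%VF.
  have [_ K] := good _ t20 t23; rewrite thetaE //; apply/lfunP => v.
  rewrite !comp_lfunE -TT' comp_lfunE; congr (s2 _).
  rewrite -[RHS](lker0_lfunK K); congr (_ _).
  rewrite /Psi three' two T1 comp_lfun1l !comp_lfunE id_lfunE s2Phi; congr (Phi 1 _).
  have /lfunP/(_ (T' 2%:R (T' 2%:R v))) := Ts' s1 _ m1 i1 x1 (invr_neq0 (nz 1)).
  by rewrite !comp_lfunE invrK Tinv' => ->.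
(* The left kernel of [M t] is the space of vectors fixed by [theta t] and negated by [s2]. At
   [t = 2] it lies in [c], and generically the rank of [M] is no smaller, so the kernel is no
   larger. *)
pose M t := row_mx (f2mx (theta t) - 1%:M) (f2mx s2 + 1%:M).
have rM : rational_mx ts M.
  apply: rational_row_mx; last exact: rational_mx_const.
  by apply: rational_mxD => //; exact: rational_mx_const.
have rA : rational_mx ts (fun t => trace_mx br (theta t) a).
  move=> i j; apply: rational_ext; first by move=> t; rewrite mxE /ltr f2mx_comp.
  apply: rational_mxtrace; apply: rational_mulmx; first exact: rational_mx_const.
  exact: rational_expmx.
have [PA PA0 PAP] := rational_rank_generic rA (mem_head _ _).
have [PM PM0 PMP] := rational_rank_generic rM in2.
(* Besides the two rank conditions, the point must avoid 0 and 3, where a torus parameter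
   vanishes. *)
have [|t tP] := @char0_nonroot k [:: PA; PM; 'X; 3%:R%:P - 'X] ch0.
  move=> p; rewrite !inE => /or4P[]/eqP-> //; first by rewrite polyX_eq0.
  by rewrite -opprB oppr_eq0 polyXsubC_eq0.
have [tA tM] : PA.[t] != 0 /\ PM.[t] != 0 by split; apply: tP; rewrite !inE eqxx ?orbT.
have [t0 t3] : t != 0 /\ 3%:R - t != 0.
  have := tP 'X; have := tP (3%:R%:P - 'X); rewrite !hornerE => A B.
  by split; [apply: B | apply: A]; rewrite !inE eqxx ?orbT.
have [Pm P0] := good t t0 t3.
have rank1 : (\dim a <= \rank (trace_mx br (theta 1%R) a))%N.
  rewrite theta1; apply: (rank_trace_mx_torus La ch0 nd bb (Tb _) wtP) => z i j za qij.
  exact: (wtq z i za).2.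
pose W := (lker (theta t - \1%VF)%R :&: lker (s2 + \1%VF)%R)%VS.
have rankt : (\rank (trace_mx br (theta t) a) <= \dim W)%N.
  have K2 := involution_lker0 i2.
  have P0' : lker (Psi t)^-1%VF == 0%VS.
    by apply/lker0P => y z /(congr1 (Psi t)); rewrite !(lker0_lfunVK P0).
  apply: (rank_trace_mx La ch0 nd) => //; rewrite ?thetaE //.
  - do 3?[apply: lie_morphism_comp => //]; exact: lie_morphism_inv.
  - by do 3?[apply: lker0_comp => //].
  - move: (Psi t) P0 => P PK v; rewrite !comp_lfunE i2 lker0_lfunVK // i2 lker0_lfunK // i2.
  - by move=> z /aA[].
have WM : (\dim W + \rank (M t) <= n)%N.
  rewrite dimvf; apply: mulmx0_rank_max; rewrite mul_mx_row.
  suff [-> ->] : vs2mx W *m (f2mx (theta t) - 1%:M) = 0 /\ vs2mx W *m (f2mx s2 + 1%:M) = 0.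
    by rewrite row_mx0.
  have inW i : r2v (row i (vs2mx W)) \in W by rewrite memv_r2v row_sub.
  split; apply/row_matrixP => i; rewrite row_mul row0 -[row i _]r2vK; apply/eqP.
    by rewrite mulmx_f2mx_sub1; have /memv_capP[] := inW i.
  by rewrite mulmx_f2mx_add1; have /memv_capP[] := inW i.
have M2 : (n <= \dim c + \rank (M 2%:R%R))%N.
  rewrite dimvf addnC -leq_subLR -mxrank_ker; apply: mxrankS; apply/row_subP => i.
  rewrite -memv_r2v; set y := row i _; have : y *m M 2%:R = 0 by rewrite -row_mul mulmx_ker row0.
  move/eqP; rewrite mul_mx_row row_mx_eq0 -{1 2}[y]r2vK mulmx_f2mx_sub1 mulmx_f2mx_add1.
  rewrite !memv_ker !add_lfunE opp_lfunE !id_lfunE theta2 subr_eq0 addr_eq0.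
  rewrite !comp_lfunE => /andP[/eqP y1 /eqP y2].
  apply: (torus_endpoint_fixed La ch0 nd m1 m2 i1 i2 s12 cP bb' Tb' wtP' _ x1 x2 Ts' y1 y2).
  by move=> z j zc; exact: (wtq' z j zc).1.
rewrite -(leq_add2r (\rank (M t))).
apply: leq_trans (leq_trans WM (leq_trans M2 _)); last by rewrite leq_add2l PMP.
by rewrite leq_add2r (leq_trans rank1) // (leq_trans (PAP t tA)).
Qed.
End Path.

(** * From the dimension bound to maximality *)

Section CommSemisimple.
Variables (k : closedFieldType) (V : vectType k) (br : V -> V -> V).

Lemma cartan_subspace_exists (P : V -> Prop) (c : {vspace V}) :
  (forall x, x \in c -> P x) -> comm_semisimple br c ->
  exists2 a, cartan_subspace br P a & (c <= a)%VS.
Proof.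
move=> cP cs.
pose Q d := exists a : {vspace V},
  [/\ (c <= a)%VS, forall x, x \in a -> P x, comm_semisimple br a & \dim a = d].
have [||_ [a [ca aP as_ <-]] mx] := @ex_max_nat Q (\dim {:V}).
- by exists (\dim c), c; split=> //; exact: subvv.
- by move=> _ [a [_ _ _ <-]]; apply/dimvS/subvf.
exists a => //; split=> // c' ac' c'P c's; apply/esym/eqP.
rewrite eqEdim ac' mx //; exists c'; split=> //; exact: subv_trans ca ac'.
Qed.

Lemma comm_semisimple_img (f : 'End(V)) (c : {vspace V}) :
  lie_morphism br f -> lker f == 0%VS -> comm_semisimple br c ->
  comm_semisimple br (f @: c)%VS.
Proof.
move=> fm f0 [cc cs]; split.
  move=> _ _ /memv_imgP[x xc ->] /memv_imgP[y yc ->].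
  by rewrite -fm cc // linear0.
move=> _ /memv_imgP[x xc ->]; have [b [bf bP]] := cs x xc.
exists (map f b); split; first by rewrite -limg_span bf lker0_limgf.
move=> _ /mapP[v /bP[r xv] ->]; exists r.
by rewrite -fm xv linearZ.
Qed.
End CommSemisimple.

Theorem theorem3p7 (k : closedFieldType) (V : vectType k) (br : V -> V -> V)
    (s1 s2 : 'End(V)) :
  [pchar k] =i pred0 ->
  semisimple_lie br ->
  dyad br s1 s2 ->
  forall c : {vspace V},
    cartan_subspace br (fun x => s1 x = - x /\ s2 x = - x) c ->
    cartan_subspace br (fun x => s1 x = - x) c /\
    cartan_subspace br (fun x => s2 x = - x) c.
Proof.
move=> ch0 ss [[m1 i1 _] [m2 i2 _] _ s12 [phi [[xs [xsn phiE]] s2phi]]] c cP.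
have La := ss.1; have nd := killing_nondegenerate La ch0 ss.
have [Phi [Phim Phi0 Phi1 Phir]] := inner_path La ch0 xsn.
have s2Phi v : s2 (Phi 1 v) = Phi 1 (s1 v) by rewrite !Phi1 -!phiE.
have [P1m P10] := Phim 1.
have dim2 (c' : {vspace V}) : (forall x, x \in c' -> s2 x = - x) -> comm_semisimple br c' ->
    (\dim c' <= \dim c)%N.
  move=> c'2 c's; have [x xc|a aP /dimvS ca] := @cartan_subspace_exists _ _ br (anti s2 s2) c' _ c's.
    by split; exact: c'2.
  apply: leq_trans ca _.
  exact: (cartan_dim_le La ch0 nd m1 m2 i1 i2 s12 Phim Phi0 Phir s2Phi aP cP).
(* [Phi 1] carries the (-1)-eigenspace of [s1] into that of [s2] and preserves dimensions, brackets
   and semisimplicity, so the bound for [s2] applies to the image. *)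
have dim1 (c' : {vspace V}) : (forall x, x \in c' -> s1 x = - x) -> comm_semisimple br c' ->
    (\dim c' <= \dim c)%N.
  move=> c'1 c's; rewrite -(limg_dim_eq (f := Phi 1)); last by rewrite (eqP P10) capv0.
  apply: dim2; last exact: comm_semisimple_img.
  by move=> _ /memv_imgP[x xc ->]; rewrite s2Phi c'1 // linearN.
have [cA cs _] := cP.
split; (split=> // [x /cA[] //|c' cc' c'P c's]; apply/esym/eqP; rewrite eqEdim cc' /=).
  exact: dim1.
exact: dim2.
Qed.
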